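(* As an $\mathrm{FI}_{3,o}$-module, with the structure maps described in the context, $H_{1}\big(F_{\bullet}(\Gamma_{3})\big)=\big(H_1(F_n(\Gamma_3))\big)_{n\ge0}$ is not finitely presentable.
   Context: Homology is taken with integer coefficients. The star graph $\Gamma_3$ has one central vertex and $3$ further vertices (leaves), each joined to the central vertex by a single edge of length $1$; edges are numbered $1,2,3$. For a space $X$, $F_n(X)=\{(x_1,\dots,x_n)\in X^n : x_a\ne x_b \text{ for } a\neq b\}$, with $S_n$ acting by relabelling ($\sigma$ turns the particle labelled $a$ into the particle labelled $\sigma(a)$); $F_0(X)$ is a point. Write $[n]=\{1,\dots,n\}$. For $d\ge1$, $\mathrm{FI}_{d,o}$ is the category with objects $[n]$, $n\ge 0$, whose morphisms $[n]\to[m]$ are triples $(f,c,o)$, where $f:[n]\to[m]$ is an injection, $c:[m]\setminus f([n])\to\{1,\dots,d\}$ is a colouring, and $o$ is a linear ordering of each colour class of $c$. Composition: $(f',c',o')\circ(f,c,o)=(f'\circ f,c'',o'')$, where $c''(x)=c(f'^{-1}(x))$ if $x\in \mathrm{Im} f'$ and $c''(x)=c'(x)$ otherwise, and in each colour class of $c''$ the elements of $\mathrm{Im} f'$ come first, in the order given by $o$ (transported along $f'$), followed by the elements outside $\mathrm{Im} f'$ in the order given by $o'$. An $\mathrm{FI}_{d,o}$-module is a covariant functor $U$ from $\mathrm{FI}_{d,o}$ to abelian groups; write $U_n=U([n])$. An FB-module $W$ is a sequence $(W_n)_{n\ge0}$ of $\mathbb{Z}[S_n]$-modules; it is finitely generated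 if $W_n=0$ for all but finitely many $n$ and each $W_n$ is a finitely generated abelian group. Let $M^{\mathrm{FI}_{d,o}}(n)$ be the $\mathrm{FI}_{d,o}$-module whose value at $[m]$ is the free abelian group on $\mathrm{Hom}_{\mathrm{FI}_{d,o}}([n],[m])$, and put $M^{\mathrm{FI}_{d,o}}(W)=\bigoplus_{n\ge0}W_n\otimes_{S_n}M^{\mathrm{FI}_{d,o}}(n)$. $U$ is finitely presentable if there are finitely generated FB-modules $V,W$ and an exact sequence $M^{\mathrm{FI}_{d,o}}(V)\to M^{\mathrm{FI}_{d,o}}(W)\to U\to0$. The $\mathrm{FI}_{3,o}$-module structure on $H_1(F_\bullet(\Gamma_3))$ is the one in which $S_n$ acts by relabelling and the morphism $[n]\to[n+1]$ given by the standard inclusion with the element $n+1$ coloured $j$ acts by the map induced by $\iota_{n,j}:F_n(\Gamma_3)\to F_{n+1}(\Gamma_3)$; here $\iota_{n,j}$ applies to every particle the map $\Gamma_3\to\Gamma_3$ that scales edge $j$ by the factor $\tfrac45$ towards the central vertex and is the identity on the other edges, and then adds a particle labelled $n+1$ at the $j$-th leaf. These maps determine the whole functor. *)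

(* Defs.v *)
From HB Require Import structures.
From mathcomp Require Import freeg.
From mathcomp Require Import all_boot all_order all_algebra all_fingroup.
From mathcomp Require Import generic_quotient ring_quotient.
From mathcomp Require Import boolp classical_sets functions reals topology normedtype.
Set Implicit Arguments.
Unset Strict Implicit.
Unset Printing Implicit Defensive.
Import Order.TTheory GRing.Theory Num.Theory.
Import numFieldNormedType.Exports.
Local Open Scope classical_set_scope.
Local Open Scope ring_scope.
Local Open Scope quotient_scope.

Section FreeAbelian.
Variables (K : choiceType) (A : zmodType).

Definition fbasis (k : K) : {freeg K} := [freeg [:: (1, k)]].

Section Ext.
Variable f : K -> A.

Definition free_ext_fun (D : {freeg K}) : A := fglift (f : K -> (zmodule A)) D.

Lemma free_ext_additive : GRing.zmod_morphism free_ext_fun.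
Proof. exact: (@lift_is_additive int K (zmodule A) f). Qed.

HB.instance Definition _ :=
  GRing.isZmodMorphism.Build {freeg K} A free_ext_fun free_ext_additive.

Definition free_ext : {additive {freeg K} -> A} := free_ext_fun.

Lemma free_extE k : free_ext (fbasis k) = f k.
Proof. by rewrite /= /free_ext_fun liftU scale1r. Qed.
End Ext.

Lemma free_ext_uniq (u v : {additive {freeg K} -> A}) :
  (forall k, u (fbasis k) = v (fbasis k)) -> u =1 v.
Proof.
move=> uv D.
have key : forall z k, u [freeg [:: (z, k)]] = v [freeg [:: (z, k)]].
  move=> z k.
  have -> : [freeg [:: (z, k)]] = fbasis k *~ z.
    apply/eqP/freeg_eqP => x.
    by rewrite raddfMz /= /fbasis !coeffU mul1r -mulrzr mulrC intz.
  by rewrite !raddfMz uv.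
rewrite -[D]freeg_repr; move: (FreegDefs.seq_of_prefreeg (repr D)) => s; elim: s => [|[z k] s IHs].
  have -> : Freeg [::] = 0 :> {freeg K} by [].
  by rewrite !raddf0.
have -> : Freeg ((z, k) :: s) = [freeg [:: (z, k)]] + Freeg s :> {freeg K}.
  apply/eqP/freeg_eqP => x.
  by rewrite coeffD !coeff_Freeg !precoeff_cons precoeff_nil addr0.
by rewrite !raddfD key IHs.
Qed.
End FreeAbelian.

(* The quotient of A by the subgroup generated by S. *)
Section Quotient.
Variables (A : zmodType) (S : set A).

Definition zspan (x : A) : bool := `[< forall I : set A, I 0 ->
  (forall u v, I u -> I v -> I (u - v)) -> S `<=` I -> I x >].

Lemma zspan_zmod_closed : zmod_closed zspan.
Proof.
split=> [|u v /asboolP uS /asboolP vS]; first by apply/asboolP => I.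
by apply/asboolP => I I0 IB SI; apply: (IB); [exact: uS|exact: vS].
Qed.

HB.instance Definition _ := GRing.isZmodClosed.Build A zspan zspan_zmod_closed.

Definition zspan_closed : zmodClosed A := GRing.ZmodClosed.clone A zspan _.
Definition quo : zmodType := (Quotient.quot zspan_closed).
Definition quo_pi (x : A) : quo := \pi_(Quotient.quot zspan_closed) x.
Lemma quo_pi_additive : GRing.zmod_morphism quo_pi.
Proof. exact: (@raddfB _ _ \pi_(Quotient.quot zspan_closed)). Qed.
HB.instance Definition _ := GRing.isZmodMorphism.Build A quo quo_pi quo_pi_additive.

Lemma quo_pi_surj (q : quo) : exists x, q = quo_pi x.
Proof. by exists (repr q); rewrite /quo_pi reprK. Qed.

Lemma zspan_sub x : S x -> x \in zspan.
Proof. by move=> Sx; apply/asboolP => I _ _; apply. Qed.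

Lemma quo_pi_eq0 x : (quo_pi x == 0) = (x \in zspan).
Proof.
have -> : 0 = quo_pi 0 :> quo by rewrite raddf0.
by rewrite -[x in RHS]subr0 /quo_pi Quotient.idealrBE.
Qed.

Section Lift.
Variables (B : zmodType) (f : {additive A -> B}).
Hypothesis f0 : forall x, S x -> f x = 0.

Lemma zspan_ker x : x \in zspan -> f x = 0.
Proof.
move=> /asboolP/(_ [set x | f x = 0]); apply => //=; first exact: raddf0.
by move=> u v; rewrite raddfB => -> ->; rewrite subr0.
Qed.

Definition quo_lift_fun (_ : forall x, S x -> f x = 0) (q : quo) : B := f (repr q).

Lemma quo_liftE_fun x : quo_lift_fun f0 (quo_pi x) = f x.
Proof.
apply/eqP; rewrite -subr_eq0 -raddfB; apply/eqP/zspan_ker.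
by rewrite Quotient.idealrBE reprK.
Qed.

Lemma quo_lift_additive : GRing.zmod_morphism (quo_lift_fun f0).
Proof.
move=> p q; have [x ->] := quo_pi_surj p; have [y ->] := quo_pi_surj q.
by rewrite -raddfB !quo_liftE_fun raddfB.
Qed.

HB.instance Definition _ :=
  GRing.isZmodMorphism.Build quo B (quo_lift_fun f0) quo_lift_additive.

Definition quo_lift : {additive quo -> B} := quo_lift_fun f0.

Lemma quo_liftE x : quo_lift (quo_pi x) = f x.
Proof. exact: quo_liftE_fun. Qed.
End Lift.

Lemma quo_pi_epi (B : zmodType) (u v : quo -> B) :
  (forall x, u (quo_pi x) = v (quo_pi x)) -> u =1 v.
Proof. by move=> uv q; have [x ->] := quo_pi_surj q. Qed.
End Quotient.

Section DirectSum.
Variable A : nat -> zmodType.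

Record dsum := DSum {
  dsum_fun :> forall n, A n;
  dsum_finP : exists N, forall n, (N <= n)%N -> dsum_fun n = 0 }.

Lemma dsum_ext (x y : dsum) : (forall n, x n = y n) -> x = y.
Proof.
case: x y => [x xP] [y yP] /= xy.
have exy : x = y by apply: functional_extensionality_dep.
by rewrite exy in xP *; congr DSum; exact: Prop_irrelevance.
Qed.

HB.instance Definition _ := gen_eqMixin dsum.
HB.instance Definition _ := gen_choiceMixin dsum.

Lemma dsum_zero_fin : exists N, forall n, (N <= n)%N -> (0 : A n) = 0.
Proof. by exists 0. Qed.
Definition dsum_zero := DSum dsum_zero_fin.

Lemma dsum_opp_fin (x : dsum) :
  exists N, forall n, (N <= n)%N -> - x n = 0.
Proof. by have [N xN] := dsum_finP x; exists N => n /xN ->; rewrite oppr0. Qed.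
Definition dsum_opp x := DSum (dsum_opp_fin x).

Lemma dsum_add_fin (x y : dsum) :
  exists N, forall n, (N <= n)%N -> x n + y n = 0.
Proof.
have [N xN] := dsum_finP x; have [M yM] := dsum_finP y.
by exists (maxn N M) => n; rewrite geq_max => /andP[/xN -> /yM ->]; rewrite addr0.
Qed.
Definition dsum_add x y := DSum (dsum_add_fin x y).

Lemma dsum_addA : associative dsum_add.
Proof. by move=> x y z; apply: dsum_ext => n /=; rewrite addrA. Qed.
Lemma dsum_addC : commutative dsum_add.
Proof. by move=> x y; apply: dsum_ext => n /=; rewrite addrC. Qed.
Lemma dsum_add0 : left_id dsum_zero dsum_add.
Proof. by move=> x; apply: dsum_ext => n /=; rewrite add0r. Qed.
Lemma dsum_addN : left_inverse dsum_zero dsum_opp dsum_add.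
Proof. by move=> x; apply: dsum_ext => n /=; rewrite addNr. Qed.

HB.instance Definition _ :=
  GRing.isZmodule.Build dsum dsum_addA dsum_addC dsum_add0 dsum_addN.
End DirectSum.

Section DirectSumMap.
Variables (A B : nat -> zmodType) (f : forall n, {additive A n -> B n}).

Lemma dsum_map_fin (x : dsum A) :
  exists N, forall n, (N <= n)%N -> f n (x n) = 0.
Proof. by have [N xN] := dsum_finP x; exists N => n /xN ->; rewrite raddf0. Qed.

Definition dsum_map_fun (x : dsum A) : dsum B := DSum (dsum_map_fin x).

Lemma dsum_map_additive : GRing.zmod_morphism dsum_map_fun.
Proof. by move=> x y; apply: dsum_ext => n /=; rewrite raddfB. Qed.

HB.instance Definition _ :=
  GRing.isZmodMorphism.Build (dsum A) (dsum B) dsum_map_fun dsum_map_additive.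

Definition dsum_map : {additive dsum A -> dsum B} := dsum_map_fun.
End DirectSumMap.

(* The tensor product over Z[G] of A and B, where G acts on A from the left and
   on B from the right: (g a) (x) b = a (x) (b g). *)
Section Tensor.
Variables (G : Type) (A B : zmodType).
Variables (actA : G -> A -> A) (actB : G -> B -> B).

Inductive tensor_rel : set {freeg A * B} :=
| TensorAddl a a' b :
    tensor_rel (fbasis (a + a', b) - (fbasis (a, b) + fbasis (a', b)))
| TensorAddr a b b' :
    tensor_rel (fbasis (a, b + b') - (fbasis (a, b) + fbasis (a, b')))
| TensorBalanced g a b :
    tensor_rel (fbasis (actA g a, b) - fbasis (a, actB g b)).

Definition tensor : zmodType := quo tensor_rel.
Definition tens (a : A) (b : B) : tensor := quo_pi tensor_rel (fbasis (a, b)).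

Lemma tensor_ext (C : zmodType) (u v : {additive tensor -> C}) :
  (forall a b, u (tens a b) = v (tens a b)) -> u =1 v.
Proof.
move=> uv; apply: quo_pi_epi => x.
apply: (free_ext_uniq (u := u \o quo_pi tensor_rel) (v := v \o quo_pi tensor_rel)).
by case=> a b; exact: uv.
Qed.

Lemma tens_eq x y : tensor_rel (x - y) -> quo_pi tensor_rel x = quo_pi tensor_rel y.
Proof.
by move=> /zspan_sub; rewrite -quo_pi_eq0 raddfB subr_eq0 => /eqP.
Qed.

Lemma tensDl a a' b : tens (a + a') b = tens a b + tens a' b.
Proof.
have <- : quo_pi tensor_rel (fbasis (a, b) + fbasis (a', b)) = tens a b + tens a' b.
  by rewrite raddfD.
exact/tens_eq/TensorAddl.
Qed.

Lemma tensDr a b b' : tens a (b + b') = tens a b + tens a b'.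
Proof.
have <- : quo_pi tensor_rel (fbasis (a, b) + fbasis (a, b')) = tens a b + tens a b'.
  by rewrite raddfD.
exact/tens_eq/TensorAddr.
Qed.

Lemma tens_balanced g a b : tens (actA g a) b = tens a (actB g b).
Proof. exact/tens_eq/TensorBalanced. Qed.
End Tensor.

Section TensorMap.
Variables (G : Type) (A B C : zmodType).
Variables (actA : G -> A -> A) (actB : G -> B -> B) (actC : G -> C -> C).
Variables (f : {additive B -> C}) (fG : forall g b, f (actB g b) = actC g (f b)).

Local Notation pre := (free_ext (fun ab : A * B => tens actA actC ab.1 (f ab.2))).

Lemma tensor_map_rel x : tensor_rel actA actB x -> pre x = 0.
Proof.
case=> [a a' b|a b b'|g a b]; rewrite raddfB.
- by rewrite raddfD !free_extE tensDl subrr.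
- by rewrite [X in _ - X]raddfD !free_extE raddfD tensDr subrr.
- by rewrite !free_extE fG tens_balanced subrr.
Qed.

Definition tensor_map : {additive tensor actA actB -> tensor actA actC} :=
  quo_lift tensor_map_rel.

Lemma tensor_mapE a b : tensor_map (tens actA actB a b) = tens actA actC a (f b).
Proof. by rewrite /tensor_map quo_liftE free_extE. Qed.
End TensorMap.

(* A morphism [n] -> [m]: the colour of an element is [None] exactly when the
   element lies in the image of [fi_map], and [fi_ord x y] says that x and y
   have the same colour and that x comes before or is equal to y. *)
Section FIdo.
Variable d : nat.

Record FIhom (n m : nat) := FIHom {
  fi_map : 'I_n -> 'I_m;
  fi_col : 'I_m -> option 'I_d;
  fi_ord : rel 'I_m;
  fi_inj : injective fi_map;
  fi_colP : forall x, fi_col x = None <-> exists i, fi_map i = x;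
  fi_ord_col : forall x y, fi_ord x y -> fi_col x <> None /\ fi_col x = fi_col y;
  fi_ord_refl : forall x, fi_col x <> None -> fi_ord x x;
  fi_ord_anti : forall x y, fi_ord x y -> fi_ord y x -> x = y;
  fi_ord_trans : forall y x z, fi_ord x y -> fi_ord y z -> fi_ord x z;
  fi_ord_total : forall x y, fi_col x <> None -> fi_col x = fi_col y ->
    fi_ord x y || fi_ord y x }.

Lemma FIhom_ext n m (u v : FIhom n m) :
  fi_map u =1 fi_map v -> fi_col u =1 fi_col v -> fi_ord u =2 fi_ord v -> u = v.
Proof.
case: u v => [f c o ? ? ? ? ? ? ?] [f' c' o' ? ? ? ? ? ? ?] /=.
move=> /funext ef /funext ec eo'; subst f' c'.
have eo : o = o' by apply/funext => x; apply/funext => y.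
subst o'; congr FIHom; exact: Prop_irrelevance.
Qed.

HB.instance Definition _ n m := gen_eqMixin (FIhom n m).
HB.instance Definition _ n m := gen_choiceMixin (FIhom n m).

Definition fi_pre n m (u : FIhom n m) (x : 'I_m) : option 'I_n :=
  [pick i | fi_map u i == x].

Lemma fi_preP n m (u : FIhom n m) x i : fi_pre u x = Some i <-> fi_map u i = x.
Proof.
rewrite /fi_pre; case: pickP => [j /eqP <-|none]; split => //.
- by case=> ->.
- by move/fi_inj ->.
- by move=> e; move: (none i); rewrite e eqxx.
Qed.

Lemma fi_preK n m (u : FIhom n m) i : fi_pre u (fi_map u i) = Some i.
Proof. exact/fi_preP. Qed.

Lemma fi_pre_None n m (u : FIhom n m) x : fi_pre u x = None <-> fi_col u x <> None.
Proof.
split=> [xN /fi_colP[i ui]|xN].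
  by move/fi_preP: ui; rewrite xN.
case E: fi_pre => [i|//]; case: xN; apply/fi_colP.
by exists i; exact/fi_preP.
Qed.

Section Comp.
Variables (n m p : nat) (v : FIhom m p) (u : FIhom n m).

Definition fi_comp_col (x : 'I_p) : option 'I_d :=
  if fi_pre v x is Some y then fi_col u y else fi_col v x.

Definition fi_comp_ord (x x' : 'I_p) : bool :=
  match fi_pre v x, fi_pre v x' with
  | Some y, Some y' => fi_ord u y y'
  | Some y, None => fi_col u y == fi_col v x'
  | None, Some _ => false
  | None, None => fi_ord v x x'
  end.

Lemma fi_comp_inj : injective (fi_map v \o fi_map u).
Proof. by move=> i j /fi_inj /fi_inj. Qed.

Lemma fi_comp_colP x :
  fi_comp_col x = None <-> exists i, (fi_map v \o fi_map u) i = x.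
Proof.
rewrite /fi_comp_col; case E: fi_pre => [y|].
  move/fi_preP: E => <-; split=> [/fi_colP[i <-]|[i /fi_inj <-]]; first by exists i.
  by apply/fi_colP; exists i.
by move/fi_pre_None: (E) => vx; split=> // -[i <-]; apply/fi_colP; exists (fi_map u i).
Qed.

Lemma fi_comp_ord_col x y : fi_comp_ord x y ->
  fi_comp_col x <> None /\ fi_comp_col x = fi_comp_col y.
Proof.
rewrite /fi_comp_col /fi_comp_ord.
case Ex: (fi_pre v x) => [x'|]; case Ey: (fi_pre v y) => [y'|] //.
- exact: fi_ord_col.
- by move/eqP=> ->; split => //; exact/fi_pre_None.
- exact: fi_ord_col.
Qed.

Lemma fi_comp_ord_refl x : fi_comp_col x <> None -> fi_comp_ord x x.
Proof.
by rewrite /fi_comp_col /fi_comp_ord; case: (fi_pre v x) => [x'|]; exact: fi_ord_refl.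
Qed.

Lemma fi_comp_ord_anti x y : fi_comp_ord x y -> fi_comp_ord y x -> x = y.
Proof.
rewrite /fi_comp_ord.
case Ex: (fi_pre v x) => [x'|]; case Ey: (fi_pre v y) => [y'|] //; last exact: fi_ord_anti.
move: Ex Ey => /fi_preP <- /fi_preP <- xy yx.
by rewrite (fi_ord_anti xy yx).
Qed.

Lemma fi_comp_ord_trans y x z : fi_comp_ord x y -> fi_comp_ord y z -> fi_comp_ord x z.
Proof.
rewrite /fi_comp_ord.
case Ex: (fi_pre v x) => [x'|]; case Ey: (fi_pre v y) => [y'|] //;
  case Ez: (fi_pre v z) => [z'|] //.
- exact: fi_ord_trans.
- by move=> /fi_ord_col[_ ->].
- by move=> /eqP -> /fi_ord_col[_ ->].
- exact: fi_ord_trans.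
Qed.

Lemma fi_comp_ord_total x y : fi_comp_col x <> None ->
  fi_comp_col x = fi_comp_col y -> fi_comp_ord x y || fi_comp_ord y x.
Proof.
rewrite /fi_comp_col /fi_comp_ord.
case Ex: (fi_pre v x) => [x'|]; case Ey: (fi_pre v y) => [y'|].
- exact: fi_ord_total.
- by move=> _ ->; rewrite eqxx.
- by move=> _ ->; rewrite eqxx.
- exact: fi_ord_total.
Qed.

Definition fi_comp : FIhom n p :=
  FIHom fi_comp_inj fi_comp_colP fi_comp_ord_col fi_comp_ord_refl
    fi_comp_ord_anti fi_comp_ord_trans fi_comp_ord_total.
End Comp.

Section Perm.
Variables (n : nat) (s : 'S_n).

Lemma fi_perm_colP (x : 'I_n) : (None : option 'I_d) = None <-> exists i, s i = x.
Proof. by split=> // _; exists (s^-1%g x); rewrite permKV. Qed.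

Definition fi_perm : FIhom n n.
refine (@FIHom n n s (fun=> None) (fun _ _ => false) perm_inj fi_perm_colP _ _ _ _ _) => //.
Defined.
End Perm.

Definition fi_id n : FIhom n n := fi_perm 1.

Section Incl.
Variables (n : nat) (j : 'I_d).

Definition incl_col (x : 'I_n.+1) : option 'I_d :=
  if x == ord_max then Some j else None.

Lemma incl_colP x : incl_col x = None <-> exists i, widen_ord (leqnSn n) i = x.
Proof.
rewrite /incl_col; split.
  case: eqVneq => // xmax _.
  have xn : (x < n)%N.
    by rewrite ltn_neqAle -ltnS ltn_ord andbT; apply: contra xmax => /eqP e; exact/eqP/val_inj.
  by exists (Ordinal xn); exact: val_inj.
by case=> i <-; case: eqVneq => // /(congr1 val)/= e; move: (ltn_ord i); rewrite e ltnn.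
Qed.

Definition fi_incl : FIhom n n.+1.
refine (@FIHom n n.+1 (widen_ord (leqnSn n)) incl_col
  (fun x y => (x == ord_max) && (y == ord_max)) _ incl_colP _ _ _ _ _).
- by move=> x y /(congr1 val) /= /val_inj.
- by move=> x y /andP[/eqP -> /eqP ->]; rewrite /incl_col eqxx.
- by move=> x; rewrite /incl_col; case: ifP.
- by move=> x y /andP[/eqP -> /eqP ->].
- by move=> y x z /andP[-> _] /andP[_ ->].
- by move=> x y; rewrite /incl_col; case: ifP => // _ _; case: ifP.
Defined.
End Incl.

Lemma fi_perm_pre n (s : 'S_n) x : fi_pre (fi_perm s) x = Some (s^-1%g x).
Proof. by apply/fi_preP; rewrite /= permKV. Qed.

Lemma fi_comp1 n m (u : FIhom n m) : fi_comp u (fi_id n) = u.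
Proof.
apply: FIhom_ext => [x|x|x y] /=; first by rewrite perm1.
  rewrite /fi_comp_col /=; case E: fi_pre => [y|//].
  by apply/esym/fi_colP; exists y; exact/fi_preP.
rewrite /fi_comp_ord /=.
case Ex: (fi_pre u x) => [x'|]; case Ey: (fi_pre u y) => [y'|] //.
- apply/esym/negP => /fi_ord_col[]; case; apply/fi_colP.
  by exists x'; exact/fi_preP.
- transitivity false.
    by apply/eqP => /esym; move/fi_pre_None: Ey.
  apply/esym/negP => /fi_ord_col[]; case; apply/fi_colP.
  by exists x'; exact/fi_preP.
- apply/esym/negP => /fi_ord_col[h1 h2]; move: h1; rewrite h2; apply; apply/fi_colP.
  by exists y'; exact/fi_preP.
Qed.

Lemma fi_1comp n m (u : FIhom n m) : fi_comp (fi_id m) u = u.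
Proof.
by apply: FIhom_ext => [x|x|x y] /=; rewrite /fi_comp_col /fi_comp_ord ?fi_perm_pre ?invg1 ?perm1.
Qed.

Lemma fi_comp_pre n m p (v : FIhom m p) (u : FIhom n m) x :
  fi_pre (fi_comp v u) x = obind (fi_pre u) (fi_pre v x).
Proof.
case E: (fi_pre v x) => [y|] /=.
  move/fi_preP: E => <-; case E: (fi_pre u y) => [z|].
    by move/fi_preP: E => <-; apply/fi_preP.
  case E': (fi_pre (fi_comp v u) _) => [z|//].
  by move/fi_preP: E' => /= /fi_inj /fi_preP; rewrite E.
case E': (fi_pre (fi_comp v u) _) => [z|//].
by move/fi_preP: E' => /= /fi_preP; rewrite E.
Qed.

Lemma fi_compA n m p q (w : FIhom p q) (v : FIhom m p) (u : FIhom n m) :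
  fi_comp w (fi_comp v u) = fi_comp (fi_comp w v) u.
Proof.
apply: FIhom_ext => [//|x|x y] /=.
  rewrite /fi_comp_col fi_comp_pre /= /fi_comp_col.
  by case: (fi_pre w x).
rewrite /fi_comp_ord !fi_comp_pre /= /fi_comp_ord /fi_comp_col.
case Ex: (fi_pre w x) => [x'|]; case Ey: (fi_pre w y) => [y'|] //=.
  by case: (fi_pre v x').
by case: (fi_pre v y').
Qed.

Lemma fi_permM n (s t : 'S_n) : fi_perm (t * s)%g = fi_comp (fi_perm s) (fi_perm t).
Proof.
by apply: FIhom_ext => [x|x|x y] /=; rewrite /fi_comp_col /fi_comp_ord ?fi_perm_pre ?permM.
Qed.

Record FImodule := FIModule {
  fim_obj :> nat -> zmodType;
  fim_act : forall n m, FIhom n m -> {additive fim_obj n -> fim_obj m};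
  fim_act1 : forall n, fim_act (fi_id n) =1 id;
  fim_actM : forall n m p (v : FIhom m p) (u : FIhom n m),
    fim_act (fi_comp v u) =1 fim_act v \o fim_act u }.

Record FImor (U V : FImodule) := FIMor {
  fim_fun :> forall n, {additive U n -> V n};
  fim_natural : forall n m (u : FIhom n m) (x : U n),
    fim_fun m (fim_act U u x) = fim_act V u (fim_fun n x) }.

Section Principal.
Variable n : nat.

Definition principal_act m p (v : FIhom m p) :
    {additive {freeg (FIhom n m)} -> {freeg (FIhom n p)}} :=
  free_ext (fun u => fbasis (fi_comp v u)).

Lemma principal_act1 m : principal_act (fi_id m) =1 id.
Proof.
apply: (free_ext_uniq (v := idfun)) => u.
by rewrite /principal_act free_extE fi_1comp.
Qed.

Lemma principal_actM m p q (w : FIhom p q) (v : FIhom m p) :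
  principal_act (fi_comp w v) =1 principal_act w \o principal_act v.
Proof.
apply: (free_ext_uniq (v := principal_act w \o principal_act v)) => u.
by rewrite /principal_act /= !free_extE fi_compA.
Qed.

Definition principal : FImodule := FIModule principal_act1 principal_actM.
End Principal.

(* The right action of S_n on M(n). *)
Definition principal_perm n m (s : 'S_n) : {additive principal n m -> principal n m} :=
  free_ext (fun u : FIhom n m => fbasis (fi_comp u (fi_perm s))).

(* Products of permutations compose from left to right, (t * s) i = s (t i), so
   [fb_actM] says that W n is a left Z[S_n]-module. *)
Record FBmodule := FBModule {
  fb_obj :> nat -> zmodType;
  fb_act : forall n, 'S_n -> {additive fb_obj n -> fb_obj n};
  fb_act1 : forall n, @fb_act n 1%g =1 id;
  fb_actM : forall n (s t : 'S_n), fb_act (t * s)%g =1 fb_act s \o fb_act t }.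

Definition fg_abelian (A : zmodType) : Prop :=
  exists (k : nat) (g : 'I_k -> A), forall x,
    exists a : 'I_k -> int, x = \sum_i g i *~ a i.

Definition fb_fg (W : FBmodule) : Prop :=
  (exists N, forall n, (N <= n)%N -> forall x : W n, x = 0) /\
  (forall n, fg_abelian (W n)).

(* M(W): the direct sum over n of the tensor products of W n and M(n) over
   Z[S_n], computed objectwise. *)
Section Induced.
Variable W : FBmodule.

Definition ind_summand (m n : nat) : zmodType :=
  tensor (@fb_act W n) (@principal_perm n m).

Lemma principal_perm_act n m p (v : FIhom m p) (s : 'S_n) x :
  fim_act (principal n) v (principal_perm m s x) =
  principal_perm p s (fim_act (principal n) v x).
Proof.
move: x; apply: (free_ext_uniq
  (u := fim_act (principal n) v \o principal_perm m s)
  (v := principal_perm p s \o fim_act (principal n) v)) => u /=.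
by rewrite /principal_act /principal_perm !free_extE fi_compA.
Qed.

Definition ind_summand_act n m p (v : FIhom m p) :
    {additive ind_summand m n -> ind_summand p n} :=
  tensor_map (@fb_act W n) (@principal_perm_act n m p v).

Lemma ind_summand_actE n m p (v : FIhom m p) (a : W n) (b : principal n m) :
  ind_summand_act n v (tens (@fb_act W n) (@principal_perm n m) a b) =
  tens (@fb_act W n) (@principal_perm n p) a (fim_act (principal n) v b).
Proof. exact: tensor_mapE. Qed.

Definition ind_act m p (v : FIhom m p) :
    {additive dsum (ind_summand m) -> dsum (ind_summand p)} :=
  dsum_map (fun n => ind_summand_act n v).

Lemma ind_act1 m : ind_act (fi_id m) =1 id.
Proof.
move=> x; apply: dsum_ext => n.
apply: (tensor_ext (u := ind_summand_act n (fi_id m)) (v := idfun)) => a b.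
by rewrite ind_summand_actE fim_act1.
Qed.

Lemma ind_actM m p q (w : FIhom p q) (v : FIhom m p) :
  ind_act (fi_comp w v) =1 ind_act w \o ind_act v.
Proof.
move=> x; apply: dsum_ext => n.
apply: (tensor_ext (u := ind_summand_act n (fi_comp w v))
  (v := ind_summand_act n w \o ind_summand_act n v)) => a b.
transitivity (ind_summand_act n w (ind_summand_act n v
  (tens (@fb_act W n) (@principal_perm n m) a b))) => //.
by rewrite !ind_summand_actE fim_actM.
Qed.

Definition induced : FImodule := FIModule ind_act1 ind_actM.
End Induced.

Definition finitely_presentable (U : FImodule) : Prop :=
  exists V W : FBmodule, [/\ fb_fg V, fb_fg W &
    exists (g : FImor (induced V) (induced W)) (p : FImor (induced W) U),
      forall n, (forall y : U n, exists x, p n x = y) /\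
        (forall x : induced W n, p n x = 0 <-> exists z, g n z = x)].
End FIdo.

Section Generation.
Variable d : nat.

Section Split.
Variables (n m : nat) (u : FIhom d n m.+1) (y : 'I_m.+1) (j : 'I_d).
Hypotheses (yj : fi_col u y = Some j) (y_last : forall z, fi_ord u y z -> z = y).

Lemma split_map_neq a : y != fi_map u a.
Proof.
apply/eqP => ya; have : fi_col u y = None by apply/fi_colP; exists a.
by rewrite yj.
Qed.

Definition split_map (a : 'I_n) : 'I_m := s2val (unlift_some (split_map_neq a)).

Lemma split_mapE a : fintype.lift y (split_map a) = fi_map u a.
Proof. by rewrite /split_map; case: unlift_some. Qed.

Definition split_hom : FIhom d n m.
refine (@FIHom d n m split_map (fun b => fi_col u (fintype.lift y b))
  (fun b c => fi_ord u (fintype.lift y b) (fintype.lift y c)) _ _ _ _ _ _ _).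
- by move=> a b ab; apply: (@fi_inj _ _ _ u); rewrite -!split_mapE ab.
- move=> b; split=> [/fi_colP[a ab]|[a <-]].
    by exists a; apply: (@lift_inj _ y); rewrite split_mapE.
  by apply/fi_colP; exists a; rewrite split_mapE.
- by move=> b c /fi_ord_col.
- by move=> b; exact: fi_ord_refl.
- by move=> b c bc cb; apply: (@lift_inj _ y); exact: fi_ord_anti bc cb.
- by move=> c b e; exact: fi_ord_trans.
- by move=> b c; exact: fi_ord_total.
Defined.

Let t : 'S_m.+1 := lift_perm ord_max y 1.
Let w := fi_comp (fi_perm d t) (fi_incl m j).

Lemma incl_lift b : fi_map (fi_incl m j) b = fintype.lift ord_max b.
Proof. by apply: val_inj; rewrite /= /bump leqNgt ltn_ord. Qed.

Lemma split_w_map b : fi_map w b = fintype.lift y b.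
Proof. by rewrite /= -[widen_ord _ b]/(fi_map (fi_incl m j) b) incl_lift lift_perm_lift perm1. Qed.

Lemma split_w_pre b : fi_pre w (fintype.lift y b) = Some b.
Proof. by rewrite -split_w_map fi_preK. Qed.

Lemma split_w_prey : fi_pre w y = None.
Proof.
case E: fi_pre => [b|//]; move/fi_preP: E => e.
by have := neq_lift y b; rewrite -split_w_map e eqxx.
Qed.

Lemma split_w_coly : fi_col w y = Some j.
Proof.
rewrite /= /fi_comp_col fi_perm_pre /= /incl_col.
by rewrite (_ : _ == _) //; apply/eqP/(canLR (permK t)); rewrite lift_perm_id.
Qed.

Lemma split_homE : u = fi_comp w split_hom.
Proof.
apply: FIhom_ext => [a|x|x z].
- by rewrite -[RHS]/(fi_map w (split_map a)) split_w_map split_mapE.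
- rewrite -[RHS]/(fi_comp_col w split_hom x) /fi_comp_col.
  case: (unliftP y x) => [b|] ->; first by rewrite split_w_pre.
  by rewrite split_w_prey split_w_coly.
- rewrite -[RHS]/(fi_comp_ord w split_hom x z) /fi_comp_ord.
  case: (unliftP y x) => [b|] ->; case: (unliftP y z) => [c|] ->;
    rewrite ?split_w_pre ?split_w_prey ?split_w_coly //.
  + apply/idP/eqP => [/fi_ord_col[_ e]|bj]; first by rewrite -yj -e.
    have /orP[//|/y_last e] : fi_ord u (fintype.lift y b) y || fi_ord u y (fintype.lift y b).
      by move: bj => /= bj; apply: fi_ord_total; rewrite bj.
    by have := neq_lift y b; rewrite e eqxx.
  + by apply/negP => /y_last e; have := neq_lift y c; rewrite e eqxx.
  + by rewrite !fi_ord_refl ?yj ?split_w_coly.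
Qed.
End Split.

Lemma FIhom_generated (P : forall n m, FIhom d n m -> Prop) :
  (forall n (s : 'S_n), P n n (fi_perm d s)) ->
  (forall n j, P n n.+1 (fi_incl n j)) ->
  (forall n m p (v : FIhom d m p) (u : FIhom d n m),
    P m p v -> P n m u -> P n p (fi_comp v u)) ->
  forall n m (u : FIhom d n m), P n m u.
Proof.
move=> Pperm Pincl Pcomp n m; elim: m n => [|m IHm] n u.
  have n0 : n = 0%N by case: n u => // n u; case: (fi_map u ord0).
  subst n; have -> : u = fi_perm d 1; last exact: Pperm.
  by apply: FIhom_ext => [] [].
have [/existsP[y0 y0P]|/existsPn none] :=
  boolP [exists y, fi_col u y != None :> option 'I_d].
  pose N z := #|[pred z' | fi_ord u z z']|.
  have [y yP ymin] := @arg_minnP _ y0 (fun y => fi_col u y != None) N y0P.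
  case yj: (fi_col u y) yP => [j|//] _.
  have y_last z : fi_ord u y z -> z = y.
    move=> yz; apply/eqP/negPn/negP => zNy.
    have zP : fi_col u z != None by have [_ <-] := fi_ord_col yz; rewrite yj.
    have := ymin z zP; rewrite leqNgt => /negP; apply.
    apply: proper_card; apply/fintype.properP; split.
      by apply/fintype.subsetP => z'; rewrite !inE; exact: fi_ord_trans.
    exists y; rewrite !inE ?fi_ord_refl ?yj //.
    by apply/negP => zy; rewrite (fi_ord_anti zy yz) eqxx in zNy.
  rewrite (split_homE yj y_last).
  by apply: (Pcomp _ _ _ _ _ _ (IHm _ _)); apply: Pcomp; [exact: Pperm|exact: Pincl].
have colN x : fi_col u x = None by apply/eqP; have := none x; rewrite negbK.
have nm : n = m.+1.
  rewrite -(card_ord n) -(card_ord m.+1) -(card_codom (@fi_inj _ _ _ u)).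
  apply: eq_card => x; rewrite !inE; have /fi_colP[a <-] := colN x.
  exact: codom_f.
subst n; have -> : u = fi_perm d (perm (@fi_inj _ _ _ u)); last exact: Pperm.
apply: FIhom_ext => [x|x|x y]; rewrite /= ?permE //.
by apply/negP => /fi_ord_col[]; rewrite colN.
Qed.

Lemma FImodule_generated (U V : FImodule d) (h : forall n, U n -> V n) :
  (forall n (s : 'S_n) x,
    h n (fim_act U (fi_perm d s) x) = fim_act V (fi_perm d s) (h n x)) ->
  (forall n j x,
    h n.+1 (fim_act U (fi_incl n j) x) = fim_act V (fi_incl n j) (h n x)) ->
  forall n m (u : FIhom d n m) x, h m (fim_act U u x) = fim_act V u (h n x).
Proof.
move=> hperm hincl n m u.
apply: (FIhom_generated (P := fun n m (u : FIhom d n m) =>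
  forall x, h m (fim_act U u x) = fim_act V u (h n x))) => //.
by move=> {}n {}m p v {}u hv hu x; rewrite !fim_actM /= hv hu.
Qed.
End Generation.

Section SingularHomology.
Variable R : realType.

Definition simplex (k : nat) : set 'rV[R]_k.+1 :=
  [set x | (forall i, 0 <= x 0 i) /\ \sum_i x 0 i = 1].
Arguments simplex : clear implicits.

Lemma continuous_set_type (X Y : topologicalType) (B : set Y) (f : X -> B) :
  continuous (set_val \o f) -> continuous f.
Proof. exact: continuous_comp_initial. Qed.

Lemma continuous_set_val (X : topologicalType) (A : set X) :
  continuous (set_val : A -> X).
Proof. exact: initial_continuous. Qed.

Lemma continuous_mx (X Y : topologicalType) m n (f : X -> 'M[Y]_(m, n)) :
  (forall i j, continuous (fun x => f x i j)) -> continuous f.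
Proof.
move=> fc x U [P xP PU]; have: \forall y \near x, forall i j, P i j (f y i j).
  have := @filter_forall _ 'I_m (fun i y => forall j, P i j (f y i j)) (nbhs x) _.
  apply=> i.
  have := @filter_forall _ 'I_n (fun j y => P i j (f y i j)) (nbhs x) _.
  by apply=> j; exact: fc (xP i j).
by apply: filterS => y yP; exact: PU.
Qed.

Lemma continuous_coord (Y : topologicalType) m n i j :
  continuous (fun M : 'M[Y]_(m, n) => M i j).
Proof.
move=> M U MU; exists (fun i' j' => if (i' == i) && (j' == j) then U else setT).
  move=> i' j'; case: ifP => [/andP[/eqP -> /eqP ->] //|_].
  exact: filterT.
by move=> N /(_ i j); rewrite !eqxx.
Qed.

Section Face.
Variables (k : nat) (i : 'I_k.+2).

Definition face_vec (x : 'rV[R]_k.+1) : 'rV[R]_k.+2 :=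
  \row_j if unlift i j is Some j' then x 0 j' else 0.

Lemma face_vec_in (x : simplex k) : face_vec (set_val x) \in simplex k.+1.
Proof.
have [x0 x1] : simplex k (set_val x) by exact: set_valP.
move: (set_val x) x0 x1 => {}x x0 x1; apply/mem_set; split=> [j|].
  by rewrite mxE; case: unliftP.
rewrite (bigD1 i) //= mxE unlift_none add0r -x1 [LHS](reindex_onto (lift i) (fun j => odflt ord0 (unlift i j))) /=.
  apply: eq_big => [j|j _]; last by rewrite mxE liftK.
  by rewrite eq_sym neq_lift liftK eqxx.
by move=> j; rewrite eq_sym => /unlift_some[j' -> ->].
Qed.

Definition face_fun (x : simplex k) : simplex k.+1 :=
  exist _ (face_vec (set_val x)) (face_vec_in x).

Lemma face_continuous : continuous face_fun.
Proof.
apply: continuous_set_type; apply: continuous_mx => i0 j.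
have -> : (fun x => (set_val \o face_fun) x i0 j) =
    (fun x : simplex k => if unlift i j is Some j' then (set_val x) 0 j' else 0).
  by apply/funext => x; rewrite /= set_valE mxE.
case: unlift => [j'|]; last exact: cst_continuous.
move=> x; apply: (@continuous_comp _ _ _ set_val (fun M : 'rV[R]_k.+1 => M 0 j')).
  exact: continuous_set_val.
exact: continuous_coord.
Qed.

HB.instance Definition _ := isContinuous.Build _ _ face_fun face_continuous.

Definition face : continuousType (simplex k) (simplex k.+1) := face_fun.
End Face.

Definition ccomp (X Y Z : topologicalType) (g : continuousType Y Z)
  (f : continuousType X Y) : continuousType X Z := g \o f.

Section Chains.
Variable X : topologicalType.

Definition singular (k : nat) := continuousType (simplex k) X.

Definition chain (k : nat) : zmodType := {freeg (singular k)}.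

(* [k.-1] is 0 for k = 0, where the boundary is the zero map *)
Definition boundary (k : nat) : {additive chain k -> chain k.-1} :=
  match k return {additive chain k -> chain k.-1} with
  | 0 => (\0 : chain 0 -> chain 0)
  | k'.+1 => free_ext (fun s : singular k'.+1 =>
      \sum_(i < k'.+2) fbasis (ccomp s (face i)) *~ (-1) ^+ i)
  end.

Definition is_cycle k : {pred chain k} := fun c => boundary k c == 0.

Lemma is_cycle_zmod_closed k : zmod_closed (@is_cycle k).
Proof.
split=> [|x y]; rewrite /in_mem /= /is_cycle ?raddf0 //.
by move=> /eqP x0 /eqP y0; rewrite raddfB x0 y0 subrr.
Qed.

HB.instance Definition _ k :=
  GRing.isZmodClosed.Build (chain k) (@is_cycle k) (@is_cycle_zmod_closed k).

Record cycle k := Cycle { cycle_val :> chain k; cycleP : cycle_val \in @is_cycle k }.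

HB.instance Definition _ k := [isSub for @cycle_val k].
HB.instance Definition _ k := [Choice of cycle k by <:].
HB.instance Definition _ k := [SubChoice_isSubZmodule of cycle k by <:].

Definition boundaries k : set (cycle k) :=
  [set z | exists c : chain k.+1, cycle_val z = boundary k.+1 c].

Arguments boundaries : clear implicits.

Definition homology (k : nat) : zmodType := quo (boundaries k).

Lemma boundaryE k (s : singular k.+1) : boundary k.+1 (fbasis s) =
  \sum_(i < k.+2) fbasis (ccomp s (face i)) *~ (-1) ^+ i.
Proof. exact: free_extE. Qed.
End Chains.
Arguments boundaries : clear implicits.

Section Functoriality.
Variables (X Y : topologicalType) (f : continuousType X Y).

Definition chain_map k : {additive chain X k -> chain Y k} :=
  free_ext (fun s : singular X k => fbasis (ccomp f s)).

Lemma chain_mapE k (s : singular X k) : chain_map k (fbasis s) = fbasis (ccomp f s).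
Proof. exact: free_extE. Qed.

Lemma chain_map_boundary k (c : chain X k) :
  boundary Y k (chain_map k c) = chain_map k.-1 (boundary X k c).
Proof.
case: k c => [c|k]; first exact/esym/raddf0.
apply: (free_ext_uniq (u := boundary Y k.+1 \o chain_map k.+1)
                      (v := chain_map k \o boundary X k.+1)) => s.
transitivity (boundary Y k.+1 (chain_map k.+1 (fbasis s))) => //.
transitivity (chain_map k (boundary X k.+1 (fbasis s))) => //.
rewrite chain_mapE !boundaryE raddf_sum; apply: eq_bigr => i _.
rewrite raddfMz chain_mapE; congr (fbasis _ *~ _).
exact/continuousEP.
Qed.

Lemma cycle_map_in k (z : cycle X k) : chain_map k (cycle_val z) \in @is_cycle Y k.
Proof.
have /eqP z0 := cycleP z.
by apply/eqP; rewrite chain_map_boundary z0 raddf0.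
Qed.

Definition cycle_map_fun k (z : cycle X k) : cycle Y k := Cycle (cycle_map_in z).

Lemma cycle_map_additive k : GRing.zmod_morphism (@cycle_map_fun k).
Proof. by move=> x y; apply: val_inj; rewrite /= raddfB. Qed.

HB.instance Definition _ k := GRing.isZmodMorphism.Build (cycle X k) (cycle Y k)
  (@cycle_map_fun k) (@cycle_map_additive k).

Definition cycle_map k : {additive cycle X k -> cycle Y k} := @cycle_map_fun k.

Lemma cycle_map_boundaries k (z : cycle X k) : boundaries X k z ->
  (quo_pi (boundaries Y k) \o cycle_map k) z = 0.
Proof.
case=> c zc; apply/eqP; rewrite /= quo_pi_eq0; apply: zspan_sub.
exists (chain_map k.+1 c).
by rewrite chain_map_boundary -zc.
Qed.

Definition homology_map k : {additive homology X k -> homology Y k} :=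
  quo_lift (@cycle_map_boundaries k).

Lemma homology_mapE k (z : cycle X k) :
  homology_map k (quo_pi _ z) = quo_pi (boundaries Y k) (cycle_map k z).
Proof. exact: quo_liftE. Qed.
End Functoriality.

Lemma homology_map_id (X : topologicalType) (f : continuousType X X) k :
  f =1 id -> homology_map f k =1 id.
Proof.
move=> f1; apply: quo_pi_epi => z; rewrite homology_mapE; congr quo_pi.
apply: val_inj => /=.
apply: (free_ext_uniq (v := idfun)) => s; rewrite chain_mapE; congr fbasis.
by apply/continuousEP => x; exact: f1.
Qed.

Lemma homology_map_comp (X Y Z : topologicalType) (h : continuousType X Z)
  (g : continuousType Y Z) (f : continuousType X Y) k :
  h =1 g \o f -> homology_map h k =1 homology_map g k \o homology_map f k.
Proof.
move=> hgf; apply: quo_pi_epi => z.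
transitivity (homology_map g k (homology_map f k (quo_pi _ z))) => //.
rewrite !homology_mapE; congr quo_pi; apply: val_inj => /=.
apply: (free_ext_uniq (u := chain_map h k) (v := chain_map g k \o chain_map f k)) => s.
transitivity (chain_map g k (chain_map f k (fbasis s))) => //.
rewrite !chain_mapE; congr fbasis.
by apply/continuousEP => x; exact: hgf.
Qed.
End SingularHomology.

Arguments simplex R k : clear implicits.
Arguments boundaries R X k : clear implicits.

Section Configurations.
Variables (n : nat) (X : topologicalType).

Definition conf : set {ptws 'I_n -> X} := [set x | injective x].

Definition conf_at (x : conf) (i : 'I_n) : X := (set_val x : 'I_n -> X) i.

Lemma conf_inj (x : conf) : injective (conf_at x).
Proof. exact: (set_valP x). Qed.

Definition mk_conf (x : 'I_n -> X) (x_inj : injective x) : conf :=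
  exist _ (x : {ptws 'I_n -> X}) (mem_set x_inj).

Lemma conf_ext (x y : conf) : conf_at x =1 conf_at y -> x = y.
Proof. by move=> xy; apply: val_inj; apply/funext => i; have := xy i; rewrite /conf_at set_valE. Qed.

Lemma conf_atE (x : 'I_n -> X) (x_inj : injective x) : conf_at (mk_conf x_inj) = x.
Proof. by rewrite /conf_at set_valE. Qed.

Lemma continuous_conf (Y : topologicalType) (f : Y -> conf) :
  (forall i, continuous (fun y => conf_at (f y) i)) -> continuous f.
Proof.
move=> fc; apply: continuous_set_type => y; apply/cvg_sup => i U.
case=> _ [[B Bo <-] By] BU.
have := fc i y B; rewrite /conf_at => /(_ _).
by move=> fB; apply: (filterS (fun z Bz => BU _ Bz)); apply: fB; exact: open_nbhs_nbhs.
Qed.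

Lemma conf_at_continuous i : continuous (fun x : conf => conf_at x i).
Proof.
move=> x; apply: (@continuous_comp _ _ _ set_val (fun f : {ptws 'I_n -> X} => f i)).
  exact: continuous_set_val.
exact: (@proj_continuous _ (fun=> X) i).
Qed.
End Configurations.

Arguments conf : clear implicits.

Section Star.
Variables (R : realType) (d : nat).

(* The union of the coordinate segments [0, e_j] in R^d: the central vertex is
   0, the j-th leaf is e_j and the j-th edge is the segment [0, e_j]. *)
Definition star : set 'rV[R]_d :=
  [set x | (forall i, 0 <= x 0 i <= 1) /\
           (forall i j, x 0 i != 0 -> x 0 j != 0 -> i = j)].

Definition star_at (x : star) (j : 'I_d) : R := (set_val x : 'rV[R]_d) 0 j.

Lemma star_ge0 x j : 0 <= star_at x j.
Proof. by have [/(_ j)/andP[]] := set_valP x. Qed.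

Lemma star_le1 x j : star_at x j <= 1.
Proof. by have [/(_ j)/andP[]] := set_valP x. Qed.

Lemma star_edge x i j : star_at x i != 0 -> star_at x j != 0 -> i = j.
Proof. by have [_] := set_valP x; exact. Qed.

Lemma star_ext (x y : star) : star_at x =1 star_at y -> x = y.
Proof.
move=> xy; apply: val_inj; apply/rowP => j.
by have := xy j; rewrite /star_at set_valE.
Qed.

Definition mk_star (v : 'I_d -> R) (v01 : forall i, 0 <= v i <= 1)
  (v_edge : forall i j, v i != 0 -> v j != 0 -> i = j) : star.
exists (\row_i v i); apply/mem_set; split=> [i|i j]; rewrite !mxE //.
exact: v_edge.
Defined.

Lemma star_atE v v01 v_edge : star_at (@mk_star v v01 v_edge) =1 v.
Proof. by move=> j; rewrite /star_at set_valE mxE. Qed.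

Lemma continuous_star (Y : topologicalType) (f : Y -> star) :
  (forall j, continuous (fun y => star_at (f y) j)) -> continuous f.
Proof.
move=> fc; apply: continuous_set_type; apply: continuous_mx => i j.
by rewrite ord1; exact: fc.
Qed.

Lemma star_at_continuous j : continuous (fun x : star => star_at x j).
Proof.
move=> x; apply: (@continuous_comp _ _ _ set_val (fun M : 'rV[R]_d => M 0 j)).
  exact: continuous_set_val.
exact: continuous_coord.
Qed.

Lemma on_edge01 (j : 'I_d) (t : R) : 0 <= t <= 1 ->
  forall i, 0 <= (if i == j then t else 0) <= 1.
Proof. by move=> t01 i; case: ifP => _; rewrite ?t01 // lexx ler01. Qed.

Lemma on_edge_edge (j : 'I_d) (t : R) (i i' : 'I_d) :
  (if i == j then t else 0) != 0 -> (if i' == j then t else 0) != 0 -> i = i'.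
Proof.
by have [->|_] := eqVneq i j; have [->|_] := eqVneq i' j; rewrite ?eqxx.
Qed.

Definition on_edge (j : 'I_d) (t : R) (t01 : 0 <= t <= 1) : star :=
  mk_star (on_edge01 j t01) (@on_edge_edge j t).

Lemma unit_interval1 : 0 <= (1 : R) <= 1. Proof. by rewrite ler01 lexx. Qed.

Definition leaf (j : 'I_d) : star := on_edge j unit_interval1.

Section Shrink.
Variable k : 'I_d -> nat.

Lemma ratio_gt0 : 0 < 4 / 5 :> R. Proof. by rewrite divr_gt0 ?ltr0n. Qed.
Lemma ratio_lt1 : 4 / 5 < 1 :> R. Proof. by rewrite ltr_pdivrMr ?ltr0n // mul1r ltr_nat. Qed.
Lemma ratio_exp_gt0 m : 0 < (4 / 5) ^+ m :> R. Proof. exact/exprn_gt0/ratio_gt0. Qed.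
Lemma ratio_exp01 m : 0 <= (4 / 5 : R) ^+ m <= 1.
Proof.
by rewrite (ltW (ratio_exp_gt0 _)) exprn_ile1 ?(ltW ratio_gt0) ?(ltW ratio_lt1).
Qed.

Lemma shrink01 (x : star) i : 0 <= (4 / 5) ^+ k i * star_at x i <= 1.
Proof.
have /andP[r0 r1] := ratio_exp01 (k i).
by rewrite mulr_ge0 ?star_ge0 // mulr_ile1 ?star_ge0 ?star_le1.
Qed.

Lemma shrink_edge (x : star) i j :
  (4 / 5) ^+ k i * star_at x i != 0 -> (4 / 5) ^+ k j * star_at x j != 0 -> i = j.
Proof. by rewrite !mulf_eq0 !negb_or => /andP[_ xi] /andP[_ xj]; exact: star_edge xi xj. Qed.

Definition shrink (x : star) : star := mk_star (shrink01 x) (@shrink_edge x).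

Lemma shrink_at x j : star_at (shrink x) j = (4 / 5) ^+ k j * star_at x j.
Proof. exact: star_atE. Qed.

Lemma shrink_inj : injective shrink.
Proof.
move=> x y xy; apply: star_ext => j; have := shrink_at x j.
by rewrite xy shrink_at => /mulfI ->//; exact/lt0r_neq0/ratio_exp_gt0.
Qed.

Lemma shrink_continuous : continuous shrink.
Proof.
apply: continuous_star => j.
have -> : (fun x => star_at (shrink x) j) =
  (fun x => (4 / 5) ^+ k j * star_at x j) by apply/funext => x; exact: shrink_at.
move=> x; apply: (@continuous_comp _ _ _ (fun y => star_at y j) ( *%R _)).
  exact: star_at_continuous.
exact: mulrl_continuous.
Qed.
End Shrink.

Section ScaleEdge.
Variable j : 'I_d.

Definition scale_edge_coord (x : star) (i : 'I_d) : R :=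
  if i == j then 4 / 5 * star_at x i else star_at x i.

Lemma scale_edge_coordE x i :
  scale_edge_coord x i = (4 / 5) ^+ (i == j) * star_at x i.
Proof. by rewrite /scale_edge_coord; case: ifP; rewrite ?expr1 ?expr0 ?mul1r. Qed.

Lemma scale_edge01 (x : star) i : 0 <= scale_edge_coord x i <= 1.
Proof. by rewrite scale_edge_coordE; exact: (shrink01 (fun i => nat_of_bool (i == j))). Qed.

Lemma scale_edge_edge (x : star) i i' :
  scale_edge_coord x i != 0 -> scale_edge_coord x i' != 0 -> i = i'.
Proof. by rewrite !scale_edge_coordE; exact: (@shrink_edge (fun i => nat_of_bool (i == j))). Qed.

Definition scale_edge (x : star) : star := mk_star (scale_edge01 x) (@scale_edge_edge x).

Lemma scale_edge_shrink : scale_edge =1 shrink (fun i => nat_of_bool (i == j)).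
Proof.
by move=> x; apply: star_ext => i; rewrite shrink_at /scale_edge star_atE scale_edge_coordE.
Qed.
End ScaleEdge.

(* The continuous map F_n -> F_m attached to u : [n] -> [m]. It is the composite
   of relabellings and of maps adding a particle at a leaf: the positions x_a
   are moved by the map scaling each edge j by (4/5)^k, where k is the size of
   the j-th colour class, and an element y of this class is put on edge j at
   distance (4/5)^r from the centre, where r is the number of elements of the
   class after y. *)
Section Place.
Variables (n m : nat) (u : FIhom d n m).

Definition class_size (j : 'I_d) : nat := #|[pred y | fi_col u y == Some j]|.
Definition later (y : 'I_m) : nat := #|[pred z | fi_ord u y z && (z != y)]|.

Definition added_coord (y : 'I_m) (j : 'I_d) : R :=
  if fi_col u y == Some j then (4 / 5) ^+ later y else 0.

Lemma added01 y j : 0 <= added_coord y j <= 1.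
Proof.
by rewrite /added_coord; case: ifP => _; rewrite ?ratio_exp01 // lexx ler01.
Qed.

Lemma added_edge y i j : added_coord y i != 0 -> added_coord y j != 0 -> i = j.
Proof.
rewrite /added_coord.
have [->|_] := eqVneq (fi_col u y) (Some i); last by rewrite eqxx.
by have [[->]|_] := eqVneq (Some i) (Some j); rewrite ?eqxx.
Qed.

Definition added (y : 'I_m) : star := mk_star (added01 y) (@added_edge y).

Lemma added_at y j : star_at (added y) j = added_coord y j.
Proof. exact: star_atE. Qed.

Definition fi_place (x : conf n star) (y : 'I_m) : star :=
  if fi_pre u y is Some a then shrink class_size (conf_at x a) else added y.

Lemma later_lt y j : fi_col u y = Some j -> (later y < class_size j)%N.
Proof.
move=> yj; apply: proper_card; apply/fintype.properP; split.
  by apply/fintype.subsetP => z; rewrite !inE => /andP[/fi_ord_col[_ e] _]; rewrite -e yj.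
by exists y; rewrite !inE ?yj ?eqxx ?andbF.
Qed.

Lemma later_ord y z : fi_ord u y z -> y != z -> (later z < later y)%N.
Proof.
move=> yz yNz; apply: proper_card; apply/fintype.properP; split.
  apply/fintype.subsetP => w /andP[/= zw wNz]; rewrite inE /= (fi_ord_trans yz zw) /=.
  apply: contra wNz => /eqP wy; subst w; exact/eqP/(fi_ord_anti yz zw).
by exists z; rewrite !inE ?eqxx ?andbF // yz eq_sym.
Qed.

Lemma later_inj y z j : fi_col u y = Some j -> fi_col u z = Some j ->
  later y = later z -> y = z.
Proof.
move=> yj zj lyz; apply/eqP/negPn/negP => yNz.
have /orP[yz|zy] : fi_ord u y z || fi_ord u z y.
  by apply: fi_ord_total; rewrite ?yj ?zj.
- by have := later_ord yz yNz; rewrite lyz ltnn.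
- by have := later_ord zy; rewrite eq_sym yNz lyz ltnn => /(_ isT).
Qed.

Lemma added_col y : fi_pre u y = None -> exists j, fi_col u y = Some j.
Proof. by move/fi_pre_None; case: (fi_col u y) => // j _; exists j. Qed.

Lemma shrink_added x y : fi_pre u y = None -> shrink class_size x <> added y.
Proof.
move=> /added_col[j yj] /(congr1 (star_at^~ j)).
rewrite shrink_at added_at /added_coord yj eqxx => e.
have : (4 / 5) ^+ class_size j * star_at x j < (4 / 5) ^+ later y.
  apply: (@le_lt_trans _ _ ((4 / 5) ^+ class_size j)).
    by rewrite ler_piMr ?star_le1 // ltW // ratio_exp_gt0.
  by rewrite ltr_iXn2l ?ratio_gt0 ?ratio_lt1 ?later_lt.
by rewrite e ltxx.
Qed.

Lemma added_inj y z : fi_pre u y = None -> added y = added z -> y = z.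
Proof.
move=> /added_col[j yj] /(congr1 (star_at^~ j)).
rewrite !added_at /added_coord yj eqxx; case: eqP => [zj|_] e; last first.
  by have := ratio_exp_gt0 (later y); rewrite e ltxx.
apply: (later_inj yj zj); apply/eqP; rewrite eqn_leq.
by rewrite -!(ler_iXn2l ratio_gt0 ratio_lt1) e lexx.
Qed.

Lemma fi_place_inj x : injective (fi_place x).
Proof.
move=> y z; rewrite /fi_place.
case Ey: (fi_pre u y) => [a|]; case Ez: (fi_pre u z) => [b|].
- move=> /shrink_inj/conf_inj ab; move/fi_preP: Ey => <-; move/fi_preP: Ez => <-.
  by rewrite ab.
- by move/shrink_added; case.
- by move/esym/shrink_added; case.
- exact: added_inj.
Qed.

Definition fi_conf_fun (x : conf n star) : conf m star := mk_conf (@fi_place_inj x).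

Lemma fi_conf_funE x : conf_at (fi_conf_fun x) = fi_place x.
Proof. exact: conf_atE. Qed.

Lemma fi_conf_continuous : continuous fi_conf_fun.
Proof.
apply: continuous_conf => y.
have -> : (fun x => conf_at (fi_conf_fun x) y) = (fun x => fi_place x y).
  by apply/funext => x; rewrite fi_conf_funE.
rewrite /fi_place; case: (fi_pre u y) => [a|]; last exact: cst_continuous.
move=> x; apply: (@continuous_comp _ _ _ (fun x => conf_at x a) (shrink class_size)).
  exact: conf_at_continuous.
exact: shrink_continuous.
Qed.

HB.instance Definition _ := isContinuous.Build _ _ fi_conf_fun fi_conf_continuous.

Definition fi_conf : continuousType (conf n star) (conf m star) := fi_conf_fun.

Lemma fi_confE x : conf_at (fi_conf x) = fi_place x.
Proof. exact: fi_conf_funE. Qed.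
End Place.

Lemma card_fi n m (v : FIhom d n m) (P : pred 'I_m) :
  #|P| = (#|[pred y | P (fi_map v y)]| +
          #|[pred z | P z && (fi_pre v z == None)]|)%N.
Proof.
rewrite -(cardID (mem (codom (fi_map v))) P); congr (_ + _)%N; last first.
  apply: eq_card => z; rewrite !inE andbC; congr (_ && _).
  apply/idP/eqP => [zN|].
    by case E: fi_pre => [a|//]; move/fi_preP: E zN => <-; rewrite codom_f.
  by move=> zN; apply/negP => /codomP[a za]; move: zN; rewrite za fi_preK.
rewrite -(card_image (@fi_inj _ _ _ v)); apply: eq_card => z; rewrite !inE.
apply/andP/fintype.imageP => [[Pz /codomP[a za]]|[a Pa ->]].
  by exists a => //; rewrite inE -za.
by split; [exact: Pa|exact: codom_f].
Qed.

Lemma class_size_comp n m p (v : FIhom d m p) (u : FIhom d n m) j :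
  class_size (fi_comp v u) j = (class_size u j + class_size v j)%N.
Proof.
rewrite /class_size (card_fi v); congr (_ + _)%N; apply: eq_card => z; rewrite !inE /=.
  by rewrite /fi_comp_col fi_preK.
rewrite /fi_comp_col; case E: (fi_pre v z) => [y|]; last by rewrite andbT.
rewrite andbF; apply/esym/eqP; move/fi_preP: E => e.
suff -> : fi_col v z = None by [].
by apply/fi_colP; exists y.
Qed.

Lemma later_comp_in n m p (v : FIhom d m p) (u : FIhom d n m) y j :
  fi_col u y = Some j ->
  later (fi_comp v u) (fi_map v y) = (later u y + class_size v j)%N.
Proof.
move=> yj; rewrite /later (card_fi v); congr (_ + _)%N; apply: eq_card => z;
  rewrite !inE /= /fi_comp_ord !fi_preK.
  by rewrite (inj_eq (@fi_inj _ _ _ v)).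
case E: (fi_pre v z) => [y'|].
  rewrite andbF; apply/esym/eqP; move/fi_preP: E => e.
  suff -> : fi_col v z = None by [].
  by apply/fi_colP; exists y'.
rewrite andbT yj eq_sym andbC; case: eqVneq => // zy.
by move: E; rewrite zy fi_preK.
Qed.

Lemma later_comp_out n m p (v : FIhom d m p) (u : FIhom d n m) z :
  fi_pre v z = None -> later (fi_comp v u) z = later v z.
Proof.
move=> zN; apply: eq_card => w; rewrite !inE /= /fi_comp_ord zN.
case E: (fi_pre v w) => [y|//]; apply/esym/negP => /andP[/fi_ord_col[h e] _].
by apply: h; rewrite e; apply/fi_colP; exists y; exact/fi_preP.
Qed.

Lemma fi_conf_id n : fi_conf (fi_id d n) =1 id.
Proof.
move=> x; apply: conf_ext => y; rewrite fi_confE /fi_place fi_perm_pre invg1 perm1.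
apply: star_ext => j; rewrite shrink_at /class_size eq_card0 ?expr0 ?mul1r //.
Qed.

Lemma fi_conf_comp n m p (v : FIhom d m p) (u : FIhom d n m) :
  fi_conf (fi_comp v u) =1 fi_conf v \o fi_conf u.
Proof.
move=> x; apply: conf_ext => z; rewrite /= !fi_confE /fi_place fi_comp_pre.
case E: (fi_pre v z) => [y|] /=; last first.
  apply: star_ext => j; rewrite !added_at /added_coord /= /fi_comp_col E.
  by rewrite later_comp_out.
rewrite fi_confE /fi_place; move/fi_preP: E => <-.
case Ey: (fi_pre u y) => [a|]; apply: star_ext => j.
  by rewrite !shrink_at class_size_comp exprD mulrA [X in X * _]mulrC.
rewrite shrink_at !added_at /added_coord /= /fi_comp_col fi_preK.
case: eqP => [yj|_]; last by rewrite mulr0.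
by rewrite (later_comp_in _ yj) exprD mulrC.
Qed.

Lemma fi_conf_perm n (s : 'S_n) x a :
  conf_at (fi_conf (fi_perm d s) x) (s a) = conf_at x a.
Proof.
rewrite fi_confE /fi_place fi_perm_pre permK.
apply: star_ext => j; rewrite shrink_at /class_size eq_card0 ?expr0 ?mul1r //.
Qed.

Lemma fi_conf_incl n j x (a : 'I_n) :
  conf_at (fi_conf (fi_incl n j) x) (widen_ord (leqnSn n) a) =
  scale_edge j (conf_at x a).
Proof.
rewrite fi_confE /fi_place (fi_preK (fi_incl n j)) scale_edge_shrink.
apply: star_ext => i; rewrite !shrink_at; congr (_ ^+ _ * _).
rewrite /class_size /=; case: eqVneq => [->|iNj].
  rewrite (eq_card (B := pred1 ord_max)) ?card1 // => y.
  by rewrite !inE /incl_col; case: ifP => // _; rewrite eqxx.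
rewrite eq_card0 // => y; rewrite !inE /incl_col; case: ifP => // _.
by apply/eqP => -[] ji; rewrite ji eqxx in iNj.
Qed.

Lemma fi_conf_incl_max n j x :
  conf_at (fi_conf (fi_incl n j) x) ord_max = leaf j.
Proof.
rewrite fi_confE /fi_place.
have -> : fi_pre (fi_incl n j) ord_max = None.
  by apply/fi_pre_None; rewrite /= /incl_col eqxx.
apply: star_ext => i; rewrite added_at /leaf /on_edge star_atE /added_coord /=.
rewrite /incl_col eqxx -[RHS]/(if _ then _ else _) /=.
have -> : (Some j == Some i) = (i == j) by apply/eqP/eqP => [[]|->].
case: ifP => // _; rewrite /later eq_card0 // => z.
by rewrite !inE /=; case: (z == ord_max); rewrite ?andbF.
Qed.

Section ConfHomology.
Variable k : nat.

Definition conf_homology_act n m (u : FIhom d n m) :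
  {additive homology R (conf n star) k -> homology R (conf m star) k} :=
  homology_map R (fi_conf u) k.

Lemma conf_homology_act1 n : conf_homology_act (fi_id d n) =1 id.
Proof. exact/homology_map_id/fi_conf_id. Qed.

Lemma conf_homology_actM n m p (v : FIhom d m p) (u : FIhom d n m) :
  conf_homology_act (fi_comp v u) =1 conf_homology_act v \o conf_homology_act u.
Proof. exact/homology_map_comp/fi_conf_comp. Qed.

(* By [FImodule_generated], the lemmas [conf_homology_perm] and
   [conf_homology_incl] determine this structure. *)
Definition conf_homology : FImodule d :=
  FIModule conf_homology_act1 conf_homology_actM.

Lemma conf_homology_perm n (s : 'S_n)
    (f : continuousType (conf n star) (conf n star)) :
  (forall x a, conf_at (f x) (s a) = conf_at x a) ->
  fim_act conf_homology (fi_perm d s) =1 homology_map R f k.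
Proof.
move=> fE; suff -> : f = fi_conf (fi_perm d s) by [].
apply/continuousEP => x; apply: conf_ext => y.
by rewrite -(permKV s y) fE fi_conf_perm.
Qed.

Lemma conf_homology_incl n j
    (iota : continuousType (conf n star) (conf n.+1 star)) :
  (forall x a, conf_at (iota x) (widen_ord (leqnSn n) a) = scale_edge j (conf_at x a)) ->
  (forall x, conf_at (iota x) ord_max = leaf j) ->
  fim_act conf_homology (fi_incl n j) =1 homology_map R iota k.
Proof.
move=> iE imax; suff -> : iota = fi_conf (fi_incl n j) by [].
apply/continuousEP => x; apply: conf_ext => y.
case: (eqVneq y ord_max) => [->|yN]; first by rewrite imax fi_conf_incl_max.
have /incl_colP[a <-] : incl_col j y = None by rewrite /incl_col (negPf yN).
by rewrite iE fi_conf_incl.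
Qed.
End ConfHomology.
End Star.

Arguments star : clear implicits.
Arguments conf_homology : clear implicits.

(* Main.v *)
From HB Require Import structures.
From mathcomp Require Import freeg.
From mathcomp Require Import zify lra.
From mathcomp Require Import all_boot all_order all_algebra all_fingroup.
From mathcomp Require Import boolp classical_sets functions.
Require Import Defs.
From mathcomp Require Import reals topology normedtype.

(** Write x_(j,a) for the operation on configurations that adds a particle a at
    the end of edge j, and D_(j,a) = x_(j,a) - x_(j,a+1); operations of distinct
    colours commute. In an induced module, a relation
    [sum x_(j,a) v_(j,a) = 0] forces each [v_(j,a)] to be a combination of
    elements [x_(i,b) w] with i <> j (the start of the exactness of a Koszul
    complex). A diagram chase shows that a finitely presentable module inherits
    this property in large degrees.

    The module H_1 violates it. The spaces F_n are connected, so for a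
    configuration s there are 1-chains e_j with boundary D_(j,j) s. The cycles
    z_ij = D_j e_i - D_i e_j satisfy D_2 z_01 - D_1 z_02 + D_0 z_12 = 0, and it
    remains to see that the class of z_01 is not a combination of elements
    x_(0,b) w and x_(1,b) w. Singular chains map to the complex M(1)^3 -> M(0)
    that records the particles crossing the centre; this map kills the
    boundaries of 2-chains. As M(0) and M(1) have no relations among the x_(j,a)
    but the ones above, such a combination would make the combinatorial type of
    s, an element of M(0) of augmentation 1, an image of M(1)^3, where the
    augmentation vanishes. *)

Set Implicit Arguments.
Unset Strict Implicit.
Unset Printing Implicit Defensive.
Import Order.TTheory GRing.Theory Num.Theory.
Import numFieldNormedType.Exports.
Local Open Scope ring_scope.

(** * Syzygies over FI_{d,o} *)

Section AddPoint.
Variable d : nat.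

Lemma fi_comp_mapE n m p (v : FIhom d m p) (u : FIhom d n m) i :
  fi_map (fi_comp v u) i = fi_map v (fi_map u i).
Proof. by []. Qed.

Lemma fi_comp_colE n m p (v : FIhom d m p) (u : FIhom d n m) x :
  fi_col (fi_comp v u) x = if fi_pre v x is Some y then fi_col u y else fi_col v x.
Proof. by []. Qed.

Lemma fi_comp_ordE n m p (v : FIhom d m p) (u : FIhom d n m) x x' :
  fi_ord (fi_comp v u) x x' =
  match fi_pre v x, fi_pre v x' with
  | Some y, Some y' => fi_ord u y y'
  | Some y, None => fi_col u y == fi_col v x'
  | None, Some _ => false
  | None, None => fi_ord v x x'
  end.
Proof. by []. Qed.

(** The map, the colouring and the order of [u] can be read off from the composite on the image of
    [v]. *)
Lemma fi_comp_cancel n m p (v : FIhom d m p) : injective (fun u : FIhom d n m => fi_comp v u).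
Proof.
move=> u u' e; apply: FIhom_ext => [i|x|x y].
- by apply: (@fi_inj _ _ _ v); have := congr1 (fun w => fi_map w i) e.
- have := congr1 (fun w => fi_col w (fi_map v x)) e.
  by rewrite /= /fi_comp_col fi_preK.
- have := congr1 (fun w => fi_ord w (fi_map v x) (fi_map v y)) e.
  by rewrite /= /fi_comp_ord !fi_preK.
Qed.

(* The morphism [m] -> [m+1] with increasing map missing a, coloured j. *)
Definition add_point m (q : 'I_d * 'I_m.+1) : FIhom d m m.+1 :=
  locked (fi_comp (fi_perm d (lift_perm ord_max q.2 1)) (fi_incl m q.1)).

Lemma add_point_map m (q : 'I_d * 'I_m.+1) b : fi_map (add_point q) b = fintype.lift q.2 b.
Proof. by rewrite /add_point -lock; exact: split_w_map. Qed.

Lemma add_point_pre m (q : 'I_d * 'I_m.+1) b : fi_pre (add_point q) (fintype.lift q.2 b) = Some b.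
Proof. by rewrite /add_point -lock; exact: split_w_pre. Qed.

Lemma add_point_pre_self m (q : 'I_d * 'I_m.+1) : fi_pre (add_point q) q.2 = None.
Proof. by rewrite /add_point -lock; exact: split_w_prey. Qed.

Lemma add_point_col_self m (q : 'I_d * 'I_m.+1) : fi_col (add_point q) q.2 = Some q.1.
Proof. by rewrite /add_point -lock; exact: split_w_coly. Qed.

(** In a composite the elements outside the image of the second morphism come last in their colour
    class. *)
Lemma add_point_last n m (q : 'I_d * 'I_m.+1) (u : FIhom d n m) y :
  fi_col (fi_comp (add_point q) u) y = Some q.1 -> fi_ord (fi_comp (add_point q) u) y q.2.
Proof.
rewrite fi_comp_colE fi_comp_ordE add_point_pre_self add_point_col_self.
case: (unliftP q.2 y) => [b|] ->; first by rewrite add_point_pre => ->.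
by rewrite add_point_pre_self fi_ord_refl ?add_point_col_self.
Qed.

(** The added point is the last element of its colour class, so the composite and the colour
    determine it. *)
Lemma add_point_same_color n m (q q' : 'I_d * 'I_m.+1) (u u' : FIhom d n m) :
  q.1 = q'.1 -> fi_comp (add_point q) u = fi_comp (add_point q') u' -> q = q'.
Proof.
case: q q' => [j a] [j' a'] /= <- {j'} e; congr (_, _).
have ca : fi_col (fi_comp (add_point (j, a)) u) a = Some j.
  by rewrite fi_comp_colE add_point_pre_self add_point_col_self.
have ca' : fi_col (fi_comp (add_point (j, a')) u') a' = Some j.
  by rewrite fi_comp_colE add_point_pre_self add_point_col_self.
apply: (@fi_ord_anti _ _ _ (fi_comp (add_point (j, a)) u)).
  by rewrite e; apply: (@add_point_last _ _ (j, a')); rewrite -e.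
by apply: (@add_point_last _ _ (j, a)); rewrite e.
Qed.

Lemma add_point_split n m (h : FIhom d n m.+1) (q : 'I_d * 'I_m.+1) :
  fi_col h q.2 = Some q.1 -> (forall z, fi_ord h q.2 z -> z = q.2) ->
  exists u, h = fi_comp (add_point q) u.
Proof. by move=> hj hlast; exists (split_hom hj); rewrite /add_point -lock; exact: split_homE. Qed.

Lemma add_point_exists n m (h : FIhom d n m.+1) : (n <= m)%N ->
  exists q u, h = fi_comp (add_point q) u.
Proof.
move=> nm.
have [/existsP[y0 y0P]|/existsPn none] :=
  boolP [exists y, fi_col h y != None :> option 'I_d]; last first.
  suff : (#|'I_m.+1| <= #|'I_n|)%N by rewrite !card_ord leqNgt ltnS nm.
  rewrite -(card_codom (@fi_inj _ _ _ h)); apply/subset_leq_card/fintype.subsetP => x _.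
  have /fi_colP[a <-] : fi_col h x = None by apply/eqP; have := none x; rewrite negbK.
  exact: codom_f.
(* [N z] counts the elements from [z] onwards in its class; its minimum is attained at a last
   element, which can be split off. *)
pose N z := #|[pred z' | fi_ord h z z']|.
have [y yP ymin] := @arg_minnP _ y0 (fun y => fi_col h y != None) N y0P.
case yj: (fi_col h y) yP => [j|//] _.
exists (j, y); apply: add_point_split => //= z yz; apply/eqP/negPn/negP => zNy.
have zP : fi_col h z != None by have [_ <-] := fi_ord_col yz; rewrite yj.
have := ymin z zP; rewrite leqNgt => /negP; apply.
apply: proper_card; apply/fintype.properP; split.
  by apply/fintype.subsetP => z'; rewrite !inE; exact: fi_ord_trans.
exists y; rewrite !inE ?fi_ord_refl ?yj //.
by apply/negP => zy; rewrite (fi_ord_anti zy yz) eqxx in zNy.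
Qed.

(** Here [a'] and [b'] are the positions of [a] and [b] before the other point is inserted. As the
    colours differ, both colour classes are singletons, so the colouring determines the order. *)
Lemma add_point_commute m (i j : 'I_d) (a b : 'I_m.+2) (a' b' : 'I_m.+1) :
  i != j -> a = fintype.lift b a' -> b = fintype.lift a b' ->
  fi_comp (add_point (j, a)) (add_point (i, b')) =
  fi_comp (add_point (i, b)) (add_point (j, a')).
Proof.
move=> ij aE bE.
have lift_comm c : fintype.lift a (fintype.lift b' c) = fintype.lift b (fintype.lift a' c).
  apply: val_inj => /=.
  move: (congr1 val aE) (congr1 val bE) => /=; rewrite /bump.
  move: (val a) (val b) (val a') (val b') (val c) => {aE bE ij c i j}a {}b {}a' {}b' c.
  by lia.
have pcases (P : 'I_m.+2 -> Prop) : P a -> P b ->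
    (forall c, P (fintype.lift a (fintype.lift b' c))) -> forall x, P x.
  move=> Pa Pb Pc x; case: (unliftP a x) => [y|] -> //.
  by case: (unliftP b' y) => [c|] -> //; rewrite -bE.
set u := fi_comp _ _; set v := fi_comp _ _.
have ua : fi_col u a = Some j
  by rewrite fi_comp_colE (add_point_pre_self (j, a)) (add_point_col_self (j, a)).
have vb : fi_col v b = Some i
  by rewrite fi_comp_colE (add_point_pre_self (i, b)) (add_point_col_self (i, b)).
have ub : fi_col u b = Some i.
  by rewrite fi_comp_colE {1}bE (add_point_pre (j, a)) (add_point_col_self (i, b')).
have va : fi_col v a = Some j.
  by rewrite fi_comp_colE {1}aE (add_point_pre (i, b)) (add_point_col_self (j, a')).
have uc c : fi_col u (fintype.lift a (fintype.lift b' c)) = None.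
  by apply/fi_colP; exists c; rewrite fi_comp_mapE (add_point_map (j, a)) (add_point_map (i, b')).
have vc c : fi_col v (fintype.lift a (fintype.lift b' c)) = None.
  by apply/fi_colP; exists c; rewrite lift_comm fi_comp_mapE (add_point_map (i, b)) (add_point_map (j, a')).
have cE : fi_col u =1 fi_col v by apply: (pcases) => [||c]; rewrite ?ua ?va ?ub ?vb ?uc ?vc.
have diag w : fi_col w a = Some j -> fi_col w b = Some i ->
    (forall c, fi_col w (fintype.lift a (fintype.lift b' c)) = None) ->
    forall x y, @fi_ord d m m.+2 w x y = (x == y) && (fi_col w x != None).
  move=> wa wb wc x y; apply/idP/andP => [xy|[/eqP <- /eqP]]; last exact: fi_ord_refl.
  have [xN xyE] := fi_ord_col xy; split; last exact/eqP.
  move: xN xyE {xy}; move: x; apply: (pcases) => [||c]; last by rewrite wc.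
  - rewrite wa => _; move: y; apply: (pcases) => [||c]; rewrite ?wa ?wb ?wc //.
    by case=> e; rewrite e eqxx in ij.
  - rewrite wb => _; move: y; apply: (pcases) => [||c]; rewrite ?wa ?wb ?wc //.
    by case=> e; rewrite e eqxx in ij.
apply: FIhom_ext => [c|//|x y].
  rewrite [LHS]fi_comp_mapE [RHS]fi_comp_mapE (add_point_map (j, a)) (add_point_map (i, b')).
  rewrite (add_point_map (i, b)) (add_point_map (j, a')).
  exact: lift_comm.
by rewrite (diag u) // (diag v) // cE.
Qed.

(** The point [q'.2] is last in its class in the common composite, hence already in [u], and
    splitting it off there gives [w]. The formula for [u'] follows by commuting the two operations
    and cancelling the outer one. *)
Lemma add_point_exchange n m (q q' : 'I_d * 'I_m.+2) (u u' : FIhom d n m.+1) :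
  q.1 != q'.1 -> fi_comp (add_point q) u = fi_comp (add_point q') u' ->
  exists a b w, [/\ q.2 = fintype.lift q'.2 a, q'.2 = fintype.lift q.2 b,
    u = fi_comp (add_point (q'.1, b)) w & u' = fi_comp (add_point (q.1, a)) w].
Proof.
case: q q' => [j a] [i b] /= ji e.
have ca : fi_col (fi_comp (add_point (j, a)) u) a = Some j.

  by rewrite fi_comp_colE (add_point_pre_self (j, a)) (add_point_col_self (j, a)).
have cb : fi_col (fi_comp (add_point (j, a)) u) b = Some i.
  by rewrite e fi_comp_colE (add_point_pre_self (i, b)) (add_point_col_self (i, b)).
have ab : a != b by apply: contra ji => /eqP ab; move: ca; rewrite {2}ab cb => -[->].
have [b' bE _] := unlift_some ab.
have [a' aE _] : { c | a = fintype.lift b c & unlift b a = Some c }.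
  by apply: unlift_some; rewrite eq_sym.
have [w uE] : exists w, u = fi_comp (add_point (i, b')) w.
  apply: add_point_split => /=.
    by move: cb; rewrite {1}bE fi_comp_colE (add_point_pre (j, a)).
  move=> z bz; apply: (@lift_inj _ a); rewrite -bE.
  have bz' : fi_ord (fi_comp (add_point (j, a)) u) b (fintype.lift a z).
    by rewrite {1}bE fi_comp_ordE !(add_point_pre (j, a)).
  apply/esym/(fi_ord_anti bz'); rewrite e; apply: (@add_point_last _ _ (i, b)).
  by rewrite -e; have [_ <-] := fi_ord_col bz'.
exists a', b', w; split=> //; apply: (@fi_comp_cancel _ _ _ (add_point (i, b))).
cbv beta; rewrite -e uE !fi_compA; congr (fi_comp _ w).
by apply: (add_point_commute _ aE bE); rewrite eq_sym.
Qed.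
End AddPoint.

(** * Spans of the operations, and syzygies in peelable modules *)

Section Span.
Variables (d : nat) (U : FImodule d).

Definition in_span m (P : pred ('I_d * 'I_m.+1)) (y : U m.+1) : Prop :=
  exists v : 'I_d * 'I_m.+1 -> U m, y = \sum_(q | P q) fim_act U (add_point q) (v q).

Variable m : nat.
Implicit Types (P : pred ('I_d * 'I_m.+1)) (y : U m.+1).

Lemma in_span0 P : in_span P (0 : U m.+1).
Proof. by exists (fun=> 0); rewrite big1 // => q _; rewrite raddf0. Qed.

Lemma in_spanB P y z : in_span P y -> in_span P z -> in_span P (y - z).
Proof.
move=> [v ->] [w ->]; exists (fun q => v q - w q).
by rewrite -sumrB; apply: eq_bigr => q _; rewrite raddfB.
Qed.

Lemma in_spanN P y : in_span P y -> in_span P (- y).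
Proof. by move=> yP; rewrite -sub0r; apply: in_spanB => //; exact: in_span0. Qed.

Lemma in_spanD P y z : in_span P y -> in_span P z -> in_span P (y + z).
Proof. by move=> yP zP; rewrite -[z]opprK; apply: in_spanB => //; exact: in_spanN. Qed.

Lemma in_span_sum P (I : finType) (J : pred I) (F : I -> U m.+1) :
  (forall i, J i -> in_span P (F i)) -> in_span P (\sum_(i | J i) F i).
Proof.
move=> FP; apply: (big_ind (in_span P)) => //; first exact: in_span0.
exact: in_spanD.
Qed.

Lemma in_span_act P q u : P q -> in_span P (fim_act U (add_point q) u).
Proof.
move=> Pq; exists (fun q' => if q' == q then u else 0).
rewrite (bigD1 q) //= eqxx big1 ?addr0 // => q' /andP[_ /negPf ->].
exact: raddf0.
Qed.
End Span.

Lemma in_span_mor d (U V : FImodule d) (f : FImor U V) m (P : pred ('I_d * 'I_m.+1)) y :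
  in_span P y -> in_span P (f m.+1 y).
Proof.
move=> [v ->]; exists (fun q => f m (v q)).
by rewrite raddf_sum; apply: eq_bigr => q _; rewrite fim_natural.
Qed.

(* The part of freeness that survives for a right inverse of each
   [add_point q]: read off the terms whose last element of colour q.1 is q.2. *)
Definition peelable d (U : FImodule d) := forall m (q : 'I_d * 'I_m.+2),
  exists pi : {additive U m.+2 -> U m.+1},
  [/\ forall u, pi (fim_act U (add_point q) u) = u,
      forall q' u, q'.1 = q.1 -> q' != q -> pi (fim_act U (add_point q') u) = 0 &
      forall q' u, q'.1 != q.1 -> exists a v,
        pi (fim_act U (add_point q') u) = fim_act U (add_point (q'.1, a)) v].

(** Apply [pi] for [q] to the relation: the term of [q] becomes [v q], the others of its colour
    vanish, and those of other colours stay in the span of their colour. The set [J] of colours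
    permits applying this to relations in which only some colours occur. *)
Lemma peelable_syzygy d (U : FImodule d) m (J : pred 'I_d)
    (v : 'I_d * 'I_m.+2 -> U m.+1) :
  peelable U -> \sum_(q | J q.1) fim_act U (add_point q) (v q) = 0 ->
  forall q, J q.1 -> in_span [pred q' | J q'.1 && (q'.1 != q.1)] (v q).
Proof.
move=> Up v0 q Jq; have [pi [pi1 pi2 pi3]] := Up m q.
have : pi (\sum_(q | J q.1) fim_act U (add_point q) (v q)) = 0 by rewrite v0 raddf0.
rewrite (bigD1 q) //= raddfD /= pi1 => /eqP; rewrite addr_eq0 => /eqP ->.
rewrite raddf_sum; apply: in_spanN; apply: in_span_sum => q' /andP[Jq' q'q].
have [e|ne] := eqVneq q'.1 q.1; first by rewrite /= pi2 //; exact: in_span0.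
have [a [w /= ->]] := pi3 q' (v q') ne.
by apply: in_span_act; rewrite /= Jq'.
Qed.

(** * Principal modules are peelable *)

Section PeelPrincipal.
Variables (d n : nat).

Lemma principal_perm_basis m (s : 'S_n) (u : FIhom d n m) :
  principal_perm d m s (fbasis u) = fbasis (fi_comp u (fi_perm d s)).
Proof. exact: free_extE. Qed.

Lemma principal_act_basis m p (v : FIhom d m p) (u : FIhom d n m) :
  fim_act (principal d n) v (fbasis u) = fbasis (fi_comp v u).
Proof. exact: free_extE. Qed.

Section Peel.
Variables (m : nat) (q : 'I_d * 'I_m.+1).

(** A partial inverse of composition with [add_point q]; the chosen factor is the only one by
    [fi_comp_cancel]. *)
Definition peel_fun (h : FIhom d n m.+1) : principal d n m :=
  if pselect (exists u, h = fi_comp (add_point q) u) is left e then fbasis (projT1 (cid e)) else 0.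

Lemma peel_fun_act u : peel_fun (fi_comp (add_point q) u) = fbasis u.
Proof.
rewrite /peel_fun; case: pselect => [e|ne]; last by case: ne; exists u.
by congr fbasis; case: cid => w /= /fi_comp_cancel.
Qed.

Lemma peel_fun0 h : (forall u, h <> fi_comp (add_point q) u) -> peel_fun h = 0.
Proof. by move=> hN; rewrite /peel_fun; case: pselect => // e; have [u /hN] := e. Qed.

Definition peel : {additive principal d n m.+1 -> principal d n m} := free_ext peel_fun.

Lemma peel_basis h : peel (fbasis h) = peel_fun h.
Proof. exact: free_extE. Qed.

(** Precomposition with an invertible morphism does not affect which [add_point q] can be split off.
    The equivariance lets the map descend to tensor products over the symmetric group. *)
Lemma peel_fun_perm s h :
  peel_fun (fi_comp h (fi_perm d s)) = principal_perm d m s (peel_fun h).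
Proof.
have [[u ->]|hN] := pselect (exists u, h = fi_comp (add_point q) u).
  by rewrite -fi_compA !peel_fun_act principal_perm_basis.
rewrite (peel_fun0 (h := h)) ?raddf0 => [|u hu]; last by apply: hN; exists u.
apply: peel_fun0 => u hu; apply: hN; exists (fi_comp u (fi_perm d s^-1)).
by rewrite fi_compA -hu -fi_compA -fi_permM mulVg fi_comp1.
Qed.

Lemma peel_perm s x : peel (principal_perm d m.+1 s x) = principal_perm d m s (peel x).
Proof.
move: x; apply: (free_ext_uniq (u := peel \o principal_perm d m.+1 s)
  (v := principal_perm d m s \o peel)) => h /=.
by rewrite principal_perm_basis !peel_basis peel_fun_perm.
Qed.

(* Several add_point q may split h; choosing one makes the sum in
   [choice_peel_sum] the identity. *)
Definition choice_peel_fun (h : FIhom d n m.+1) : principal d n m :=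
  if [pick r | `[< exists u, h = fi_comp (add_point r) u >]] == Some q
  then peel_fun h else 0.

Definition choice_peel : {additive principal d n m.+1 -> principal d n m} :=
  free_ext choice_peel_fun.

Lemma choice_peel_perm s x :
  choice_peel (principal_perm d m.+1 s x) = principal_perm d m s (choice_peel x).
Proof.
move: x; apply: (free_ext_uniq (u := choice_peel \o principal_perm d m.+1 s)
  (v := principal_perm d m s \o choice_peel)) => h /=.
rewrite principal_perm_basis /choice_peel !free_extE /choice_peel_fun.
have -> : [pick r | `[< exists u, fi_comp h (fi_perm d s) = fi_comp (add_point r) u >]] =
    [pick r | `[< exists u, h = fi_comp (add_point r) u >]].
  apply: eq_pick => r; apply: asbool_equiv_eq; split=> [[u hu]|[u ->]].
    exists (fi_comp u (fi_perm d s^-1)).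
    by rewrite fi_compA -hu -fi_compA -fi_permM mulVg fi_comp1.
  by exists (fi_comp u (fi_perm d s)); rewrite fi_compA.
by case: eqP => _; rewrite ?raddf0 ?peel_fun_perm.
Qed.
End Peel.

Lemma peel_act m (q : 'I_d * 'I_m.+1) x :
  peel q (fim_act (principal d n) (add_point q) x) = x.
Proof.
move: x; apply: (free_ext_uniq (u := peel q \o fim_act (principal d n) (add_point q))
  (v := idfun)) => h /=.
by rewrite principal_act_basis peel_basis peel_fun_act.
Qed.

Lemma peel_act_same m (q q' : 'I_d * 'I_m.+1) x : q'.1 = q.1 -> q' != q ->
  peel q (fim_act (principal d n) (add_point q') x) = 0.
Proof.
move=> e ne; move: x.
apply: (free_ext_uniq (u := peel q \o fim_act (principal d n) (add_point q'))
  (v := \0)) => h /=.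
rewrite principal_act_basis peel_basis peel_fun0 // => u hu.
by move: ne; rewrite (add_point_same_color e hu) eqxx.
Qed.

(** A point cannot carry two colours: [add_point_exchange] would place [a] in the image of
    [lift a]. *)
Lemma peel_act_aligned m (j i : 'I_d) (a : 'I_m.+2) x : j != i ->
  peel (j, a) (fim_act (principal d n) (add_point (i, a)) x) = 0.
Proof.
move=> ji; move: x.
apply: (free_ext_uniq (u := peel (j, a) \o fim_act (principal d n) (add_point (i, a)))
  (v := \0)) => h /=.
rewrite principal_act_basis peel_basis peel_fun0 // => u hu.
have [b [c [w [/= bE _ _ _]]]] :=
  @add_point_exchange _ _ _ (j, a) (i, a) _ _ ji (esym hu).
by have := neq_lift a b; rewrite -bE eqxx.
Qed.

(** By the exchange property, [(j, a)] splits off after adding [(i, b)] exactly when [(j, a')]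
    splits off before. *)
Lemma peel_act_other m (j i : 'I_d) (a b : 'I_m.+2) (a' b' : 'I_m.+1) x :
  j != i -> a = fintype.lift b a' -> b = fintype.lift a b' ->
  peel (j, a) (fim_act (principal d n) (add_point (i, b)) x) =
  fim_act (principal d n) (add_point (i, b')) (peel (j, a') x).
Proof.
move=> ji aE bE; move: x.
apply: (free_ext_uniq (u := peel (j, a) \o fim_act (principal d n) (add_point (i, b)))
  (v := fim_act (principal d n) (add_point (i, b')) \o peel (j, a'))) => h /=.
rewrite principal_act_basis !peel_basis.
have ij : i != j by rewrite eq_sym.
have [[u ->]|hN] := pselect (exists u, h = fi_comp (add_point (j, a')) u).
  by rewrite fi_compA -(add_point_commute ij aE bE) -fi_compA !peel_fun_act principal_act_basis.
rewrite (peel_fun0 (h := h)) ?raddf0 => [|u hu]; last by apply: hN; exists u.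
apply: peel_fun0 => u hu; apply: hN.
have [c [e [w [/= cE _ _ hE]]]] :=
  @add_point_exchange _ _ _ (j, a) (i, b) _ _ ji (esym hu).
by exists w; rewrite hE; congr (fi_comp (add_point (_, _)) _); apply: (@lift_inj _ b); rewrite -cE.
Qed.

(** The bound [n <= m] leaves a point outside the image of each basis morphism, so some operation
    can be split off, and the pick selects exactly one. *)
Lemma choice_peel_sum m (x : principal d n m.+1) : (n <= m)%N ->
  x = \sum_q fim_act (principal d n) (add_point q) (choice_peel q x).
Proof.
move=> nm; move: x.
pose v x : principal d n m.+1 :=
  \sum_q fim_act (principal d n) (add_point q) (choice_peel q x).
have v_add : GRing.zmod_morphism v.
  by move=> x y; rewrite /v -sumrB; apply: eq_bigr => q _; rewrite !raddfB.
pose vA : {additive principal d n m.+1 -> principal d n m.+1} :=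
  HB.pack v (GRing.isZmodMorphism.Build _ _ v v_add).
apply: (free_ext_uniq (u := idfun) (v := vA)) => h; rewrite /= /v.
have [r0 [u0 h0]] := add_point_exists h nm.
case pE: [pick r | `[< exists u, h = fi_comp (add_point r) u >]] => [r|]; last first.
  move: pE; case: pickP => // /(_ r0) /asboolP rN _; case: rN; by exists u0.
have [u hE] : exists u, h = fi_comp (add_point r) u.
  by move: pE; case: pickP => // r' /asboolP hr [<-].
have cE q : choice_peel q (fbasis h) = if q == r then fbasis u else 0.
  rewrite /choice_peel free_extE /choice_peel_fun pE.
  have -> : (Some r == Some q) = (q == r) by rewrite eq_sym.
  case: eqVneq => // ->.
  by rewrite hE peel_fun_act.
rewrite (bigD1 r) //= cE eqxx principal_act_basis -hE big1 ?addr0 // => q /negPf qr.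
by rewrite cE qr raddf0.
Qed.
End PeelPrincipal.

Lemma principal_peelable d n : peelable (principal d n).
Proof.
move=> m [j a]; exists (peel n (j, a)); split=> [u|q' u|[i b] u /= ij].
- exact: peel_act.
- exact: peel_act_same.
have ji : j != i by rewrite eq_sym.
have [<-|ab] := eqVneq a b.
  (* The value is zero here, so any position with the zero element is a witness. *)
  by exists ord0, 0; rewrite peel_act_aligned // raddf0.
have [b' bE _] := unlift_some ab.
have [a' aE _] : { c | a = fintype.lift b c & unlift b a = Some c }.
  by apply: unlift_some; rewrite eq_sym.
by exists b', (peel n (j, a') u); apply: peel_act_other.
Qed.

Lemma tens0 (G : Type) (A B : zmodType) (actA : G -> A -> A) (actB : G -> B -> B) a :
  tens actA actB a 0 = 0.
Proof. by apply: (addIr (tens actA actB a 0)); rewrite -tensDr !add0r. Qed.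

Lemma tens0l (G : Type) (A B : zmodType) (actA : G -> A -> A) (actB : G -> B -> B) b :
  tens actA actB 0 b = 0.
Proof. by apply: (addIr (tens actA actB 0 b)); rewrite -tensDl !add0r. Qed.

(** * Induced and finitely presentable modules *)

Section PeelInduced.
Variables (d : nat) (W : FBmodule).

Definition summand_peel m n (q : 'I_d * 'I_m.+1) :
    {additive ind_summand d W m.+1 n -> ind_summand d W m n} :=
  tensor_map (actC := @principal_perm d n m) (@fb_act W n) (fun s x => @peel_perm d n m q s x).

Lemma summand_peelE m n (q : 'I_d * 'I_m.+1) w h :
  summand_peel n q (tens (@fb_act W n) (@principal_perm d n m.+1) w h) =
  tens (@fb_act W n) (@principal_perm d n m) w (peel n q h).
Proof. exact: tensor_mapE. Qed.

Definition summand_choice_peel m n (q : 'I_d * 'I_m.+1) :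
    {additive ind_summand d W m.+1 n -> ind_summand d W m n} :=
  tensor_map (actC := @principal_perm d n m) (@fb_act W n)
    (fun s x => @choice_peel_perm d n m q s x).

Lemma summand_choice_peelE m n (q : 'I_d * 'I_m.+1) w h :
  summand_choice_peel n q (tens (@fb_act W n) (@principal_perm d n m.+1) w h) =
  tens (@fb_act W n) (@principal_perm d n m) w (choice_peel n q h).
Proof. exact: tensor_mapE. Qed.

Definition induced_peel m (q : 'I_d * 'I_m.+1) : {additive induced d W m.+1 -> induced d W m} :=
  dsum_map (fun n => summand_peel n q).

Definition induced_choice_peel m (q : 'I_d * 'I_m.+1) :
    {additive induced d W m.+1 -> induced d W m} :=
  dsum_map (fun n => summand_choice_peel n q).

Lemma induced_peelable : peelable (induced d W).
Proof.
move=> m [j a]; exists (induced_peel (j, a)).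
(* Each of the three properties is an equality of additive maps, to be checked on pure tensors in
   every summand. *)
have ext (q' : 'I_d * 'I_m.+2)
    (f : forall n, {additive ind_summand d W m.+1 n -> ind_summand d W m.+1 n}) :
    (forall n w h, summand_peel n (j, a) (ind_summand_act W n (add_point q')
       (tens (@fb_act W n) (@principal_perm d n m.+1) w h)) =
     f n (tens (@fb_act W n) (@principal_perm d n m.+1) w h)) ->
    forall u, induced_peel (j, a) (fim_act (induced d W) (add_point q') u) = dsum_map f u.
  move=> fE u; apply: dsum_ext => n.
  by apply: (tensor_ext (u := summand_peel n (j, a) \o ind_summand_act W n _)) => w h; exact: fE.
split=> [u|q' u e ne|[i b] u ij].
- rewrite (ext _ (fun=> idfun)); first by apply: dsum_ext.
  by move=> n w h; rewrite ind_summand_actE summand_peelE peel_act.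
- rewrite (ext _ (fun=> \0)); first by apply: dsum_ext.
  by move=> n w h; rewrite ind_summand_actE summand_peelE peel_act_same // tens0.
have ji : j != i by rewrite eq_sym.
have [<-|ab] := eqVneq a b.
  exists ord0, 0; rewrite raddf0 (ext _ (fun=> \0)); first by apply: dsum_ext.
  by move=> n w h; rewrite ind_summand_actE summand_peelE peel_act_aligned // tens0.
have [b' bE _] := unlift_some ab.
have [a' aE _] : { c | a = fintype.lift b c & unlift b a = Some c }.
  by apply: unlift_some; rewrite eq_sym.
exists b', (induced_peel (j, a') u).
rewrite (ext _ (fun n => ind_summand_act W n (add_point (i, b')) \o summand_peel n (j, a'))).
  exact: dsum_ext.
move=> n w h; rewrite -[RHS]/(ind_summand_act W n _ (summand_peel n _ (tens _ _ w h))).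
by rewrite ind_summand_actE !summand_peelE ind_summand_actE (peel_act_other _ ji aE bE).
Qed.

(** A summand generated in degree [n <= m] is covered by [choice_peel_sum], and the remaining
    summands are zero by hypothesis. *)
Lemma induced_choice_peel_sum m (x : induced d W m.+1) :
  (forall n, (m < n)%N -> forall w : W n, w = 0) ->
  x = \sum_q fim_act (induced d W) (add_point q) (induced_choice_peel q x).
Proof.
move=> W0; pose ev n : induced d W m.+1 -> ind_summand d W m.+1 n := fun y => y n.
have ev_add n : GRing.zmod_morphism (ev n) by [].
pose evA n : {additive induced d W m.+1 -> ind_summand d W m.+1 n} :=
  HB.pack (ev n) (GRing.isZmodMorphism.Build _ _ (ev n) (ev_add n)).
apply: dsum_ext => n; rewrite -[RHS]/(evA n _) raddf_sum.
pose v (y : ind_summand d W m.+1 n) :=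
  \sum_q ind_summand_act W n (add_point q) (summand_choice_peel n q y).
have v_add : GRing.zmod_morphism v.
  by move=> y z; rewrite /v -sumrB; apply: eq_bigr => q _; rewrite !raddfB.
pose vA : {additive ind_summand d W m.+1 n -> ind_summand d W m.+1 n} :=
  HB.pack v (GRing.isZmodMorphism.Build _ _ v v_add).
apply: (tensor_ext (u := idfun) (v := vA)) => w h; rewrite -[RHS]/(v _) /v.
have [nm|mn] := leqP n m; last first.
  rewrite (W0 n mn w) tens0l big1 ?raddf0 // => q _; by rewrite !raddf0.
pose t y := tens (@fb_act W n) (@principal_perm d n m.+1) w y.
have t_add : GRing.zmod_morphism t.
  by move=> y z; apply/eqP; rewrite eq_sym subr_eq -tensDr subrK.
pose tA : {additive principal d n m.+1 -> ind_summand d W m.+1 n} :=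
  HB.pack t (GRing.isZmodMorphism.Build _ _ t t_add).
rewrite -[LHS]/(tA h) {1}(choice_peel_sum h nm) raddf_sum; apply: eq_bigr => q _.
by rewrite summand_choice_peelE ind_summand_actE.
Qed.
End PeelInduced.

(** Lift the relation along [p]. The lifted sum lies in the image of [g], and in large degrees its
    preimage [z] is a sum of added points, so the lifts can be corrected by elements of the image of
    [g] to give a true relation in [induced d W]. Peel there and apply [p], which kills the
    corrections. The bound [N] is the one beyond which [V] vanishes. *)
Lemma fp_syzygy d (U : FImodule d) : finitely_presentable U ->
  exists N, forall m, (N <= m)%N -> forall (q : 'I_d * 'I_m.+2) (u : U m.+1),
    in_span (predC1 q) (fim_act U (add_point q) u) ->
    in_span [pred q' | q'.1 != q.1] u.
Proof.
case=> V [W [[[N VN] _] _ [g [p gp]]]]; exists N => m Nm q u [v uE].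
have p_surj k y : exists x, p k x = y by have [/(_ y)] := gp k.
(* The hypothesis rewritten as a relation whose coefficient at [q] is [u]. *)
pose v' q' := if q' == q then u else - v q'.
have v'0 : \sum_q' fim_act U (add_point q') (v' q') = 0.
  rewrite (bigD1 q) //= {1}/v' eqxx uE -big_split big1 //= => q' /negPf qq'.
  by rewrite /v' qq' raddfN subrr.
have [w wE] := choice (fun q' => p_surj _ (v' q')).
pose r := \sum_q' fim_act (induced d W) (add_point q') (w q').
have : p m.+2 r = 0.
  rewrite raddf_sum -[RHS]v'0; apply: eq_bigr => q' _.
  by rewrite fim_natural wE.
have [_ /(_ r)->] := gp m.+2; case=> z zr.
have zE := @induced_choice_peel_sum d V m.+1 z _.
have {zE} zE : z = \sum_q' fim_act (induced d V) (add_point q') (induced_choice_peel V q' z).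
  by apply: zE => n mn x; apply: VN; exact: leq_trans Nm (ltnW (ltnW mn)).
have gz : g m.+2 z = \sum_q' fim_act (induced d W) (add_point q')
    (g m.+1 (induced_choice_peel V q' z)).
  by rewrite {1}zE raddf_sum; apply: eq_bigr => q' _; exact: fim_natural.
(* The corrected lifts satisfy the relation in [induced d W] itself. *)
have r0 : \sum_(q' | predT q'.1) fim_act (induced d W) (add_point q')
    (w q' - g m.+1 (induced_choice_peel V q' z)) = 0.
  rewrite -[RHS](subrr r) -{2}zr gz -sumrB.
  by apply: eq_bigr => q' _; exact: (raddfB (fim_act (induced d W) (add_point q'))).
have := peelable_syzygy (@induced_peelable d W) r0 (q := q) isT.
move=> /(in_span_mor p); rewrite raddfB wE /v' eqxx /=.
have -> : p m.+1 (g m.+1 (induced_choice_peel V q z)) = 0.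
  by have [_ /(_ (g m.+1 (induced_choice_peel V q z)))->] := gp m.+1; exists (induced_choice_peel V q z).
by rewrite subr0.
Qed.

(** * Local cocycles on simplices *)

Local Open Scope classical_set_scope.

Section SimplexIntegration.
Variables (R : realType) (k : nat).
Local Notation K := (simplex R k).
Implicit Types x y : K.

Lemma simplex_in x : simplex R k (set_val x).
Proof. exact: set_valP. Qed.

Lemma simplex_norm (v : 'rV[R]_k.+1) : simplex R k v -> `|v| <= 1.
Proof.
move=> [v0 v1]; rewrite [leLHS]/Num.norm /= mx_normrE; apply/bigmax_leP; split=> // -[i j] _ /=.
rewrite ord1 ger0_norm // -v1 (bigD1 j) //= lerDl sumr_ge0 // => l _; exact: v0.
Qed.

Lemma simplex_closed : closed (simplex R k).
Proof.
have -> : simplex R k = \bigcap_(i in [set: 'I_k.+1]) [set v : 'rV[R]_k.+1 | 0 <= v 0 i] `&`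
    [set v : 'rV[R]_k.+1 | \sum_i v 0 i = 1].
  apply/seteqP; split=> v [v0 v1]; split=> // i; first by move=> _; exact: v0.
  exact: v0.
apply: closedI.
  apply: closed_bigI => i _.
  apply: (@preimage_closed _ _ (fun v : 'rV[R]_k.+1 => v 0 i) [set z | 0 <= z]).
    by move=> v _; exact: continuous_coord.
  exact: closed_ge.
apply: (@preimage_closed _ _ (fun v : 'rV[R]_k.+1 => \sum_i v 0 i) [set z | z = 1]).
  move=> v _; apply: (@continuous_big _ _ +%R) => // [|i _]; first exact: add_continuous.
  exact: continuous_coord.
exact: closed_eq.
Qed.

Lemma simplex_compact : compact (simplex R k).
Proof.
apply: bounded_closed_compact simplex_closed.
exists 1; split; first exact: num_real.
by move=> M M1 v /simplex_norm vle; apply: le_trans vle (ltW M1).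
Qed.

Lemma simplex_nbhs x (N : set K) : nbhs x N ->
  exists2 e : R, 0 < e & forall y, `|set_val x - set_val y| < e -> N y.
Proof.
move=> [_ [[B Bo <-] Bx] BN].
have /nbhs_normP[e /= e0 eB] : nbhs (set_val x) B by exact: open_nbhs_nbhs.
by exists e => // y xy; apply: BN; apply: eB.
Qed.

Lemma rV_ball (v : 'rV[R]_k.+1) (e : R) : 0 < e -> nbhs v [set w | `|v - w| < e].
Proof. by move=> e0; apply: nbhs_le_nbhs_norm; exists e. Qed.

Lemma simplex_ball x (e : R) : 0 < e -> nbhs x [set y | `|set_val x - set_val y| < e].
Proof.
move=> e0; apply: (@continuous_set_val _ (simplex R k) x [set v | `|set_val x - v| < e]).
exact: rV_ball.
Qed.

(** The Lebesgue number lemma. As [good] is not assumed to pass to subsets, the conclusion provides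
    a good set containing the ball. *)
Lemma simplex_lebesgue (good : set K -> Prop) :
  (forall x, exists2 N, nbhs x N & good N) ->
  exists2 e : R, 0 < e & forall x, exists2 N : set K, good N &
    forall y, `|set_val x - set_val y| < e -> N y.
Proof.
move=> hgood.
have := simplex_compact; rewrite compact_near_coveringP.
move=> /(_ R 0^'+ (fun e v => forall x, set_val x = v -> exists2 N : set K, good N &
    forall y, `|v - set_val y| < e -> N y) _) cov.
have : \forall e \near 0^'+, forall x, exists2 N : set K, good N &
    forall y, `|set_val x - set_val y| < e -> N y.
  have : \forall e \near 0^'+, simplex R k `<=` (fun v => forall x, set_val x = v ->
      exists2 N : set K, good N & forall y, `|v - set_val y| < e -> N y).
    apply: cov => v Kv.
    pose x : K := exist _ v (mem_set Kv).
    have xv : set_val x = v by rewrite set_valE.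
    have [N xN gN] := hgood x; have [e e0 eN] := simplex_nbhs xN.
    (* With half the radius, balls about points close to [v] stay in the ball of radius [e] about
       [v]. *)
    have e20 : 0 < e / 2 by rewrite divr_gt0.
    exists ([set w | `|v - w| < e / 2], [set t | t < e / 2]) => /=.
      split; last exact: nbhs_right_lt.
      exact: rV_ball.
    move=> [w t] /= [vw te] y yw; exists N => // z wz.
    apply: eN; rewrite xv -(subrKA w) (le_lt_trans (ler_normD _ _)) //.
    by rewrite [e]splitr ltrD // (lt_trans wz).
  by apply: filterS => e eK x; apply: (eK _ (simplex_in x)); rewrite set_valE.
move=> he.
have : \forall e \near 0^'+, 0 < e /\ forall x, exists2 N : set K, good N &
    forall y, `|set_val x - set_val y| < e -> N y.
  near=> e; split; near: e; [exact: nbhs_right_gt|exact: he].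
by move=> /filter_ex[e [e0 ex]]; exists e.
Unshelve. all: by end_near. Qed.

(** The affine combination falls back to [x] when it leaves the simplex, so that [t] may be any real
    number. *)
Definition conv x y (t : R) : K := insubd x ((1 - t) *: set_val x + t *: set_val y).

Lemma convE x y t : 0 <= t <= 1 ->
  set_val (conv x y t) = (1 - t) *: set_val x + t *: set_val y.
Proof.
move=> /andP[t0 t1]; rewrite set_valE insubdK ?set_valE //; apply/mem_set.
have [x0 x1] := simplex_in x; have [y0 y1] := simplex_in y; split=> [i|].
  by rewrite !mxE addr_ge0 // mulr_ge0 // subr_ge0.
under eq_bigr do rewrite !mxE.
by rewrite big_split /= -!mulr_sumr x1 y1 !mulr1 subrK.
Qed.

Lemma conv0 x y : conv x y 0 = x.
Proof.
by apply: val_inj; rewrite -!set_valE convE ?lexx ?ler01 // subr0 scale1r scale0r addr0.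
Qed.

Lemma conv1 x y : conv x y 1 = y.
Proof.
by apply: val_inj; rewrite -!set_valE convE ?lexx ?ler01 // subrr scale0r scale1r add0r.
Qed.

Lemma simplex_dist x y : `|set_val x - set_val y| <= 2.
Proof.
have := ler_normD (set_val x) (- set_val y); rewrite normrN => h.
have := simplex_norm (simplex_in x); have := simplex_norm (simplex_in y).
by lra.
Qed.

Lemma conv_step x y t u : 0 <= t <= 1 -> 0 <= u <= 1 ->
  `|set_val (conv x y t) - set_val (conv x y u)| <= `|u - t| * 2.
Proof.
move=> t01 u01; rewrite !convE //.
have -> : (1 - t) *: set_val x + t *: set_val y - ((1 - u) *: set_val x + u *: set_val y)
    = (u - t) *: (set_val x - set_val y).
  by apply/rowP => i; rewrite !mxE; lra.
by rewrite normrZ ler_wpM2l // simplex_dist.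
Qed.

Lemma conv_dist x y z t : 0 <= t <= 1 ->
  `|set_val (conv x y t) - set_val (conv x z t)| <= `|set_val y - set_val z|.
Proof.
move=> t01; rewrite !convE //.
have -> : (1 - t) *: set_val x + t *: set_val y - ((1 - t) *: set_val x + t *: set_val z)
    = t *: (set_val y - set_val z).
  by apply/rowP => i; rewrite !mxE; lra.
by move/andP: t01 => [t0 t1]; rewrite normrZ ger0_norm // ler_piMl.
Qed.

(** The factor 2 is the bound on distances from [simplex_dist]. *)
Lemma fine_mesh (e : R) : 0 < e -> exists2 m, (0 < m)%N & (m%:R : R)^-1 * 2 < e.
Proof.
move=> e0; exists (Num.bound (2 / e)).+1 => //.
have := @archi_boundP R (2 / e) (divr_ge0 (ler0n _ 2) (ltW e0)).
move=> h; rewrite mulrC ltr_pdivrMr ?ltr0n // mulrC -ltr_pdivrMr //.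
by apply: lt_trans h _; rewrite ltr_nat.
Qed.

Lemma mesh01 (m i : nat) : (i <= m)%N -> 0 <= (i%:R / m%:R : R) <= 1.
Proof.
case: m => [|m] im; first by rewrite invr0 mulr0 lexx ler01.
by rewrite divr_ge0 ?ler0n //= ler_pdivrMr ?ltr0n // mul1r ler_nat.
Qed.

Lemma mesh_step (m i : nat) (e : R) x y : (m%:R : R)^-1 * 2 < e -> (i < m)%N ->
  `|set_val (conv x y (i%:R / m%:R)) - set_val (conv x y (i.+1%:R / m%:R))| < e.
Proof.
move=> me im; apply: le_lt_trans me.
apply: (le_trans (conv_step _ _ (mesh01 (ltnW im)) (mesh01 im))).
by rewrite -mulrBl -natrB // subSnn mul1r ger0_norm // invr_ge0 ler0n.
Qed.

Definition locally (Q : K -> K -> Prop) :=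
  forall x, exists2 N : set K, nbhs x N & forall y z, N y -> N z -> Q y z.

(** The simplex is convex: walk from [x] to [y] along the segment in steps shorter than a Lebesgue
    number. *)
Lemma locally_constant (T : Type) (G : K -> T) :
  locally (fun y z => G y = G z) -> forall x y, G x = G y.
Proof.
move=> /(@simplex_lebesgue (fun N => forall y z, N y -> N z -> G y = G z))[e e0 eG] x y.
have [m m0 me] := fine_mesh e0.
have steps i : (i <= m)%N -> G (conv x y (i%:R / m%:R)) = G x.
  elim: i => [_|i IHi im]; first by rewrite mul0r conv0.
  rewrite -(IHi (ltnW im)); have [N NG eN] := eG (conv x y (i%:R / m%:R)).
  by apply: NG; apply: eN; [exact: mesh_step|rewrite subrr normr0].
by rewrite -(steps m (leqnn m)) divff ?conv1 // pnatr_eq0 -lt0n.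
Qed.

(* Sum c along a fine subdivision of the segment from a base point; the
   differences between neighbouring segments telescope. *)
Lemma locally_primitive (A : zmodType) (c : K -> K -> A) :
  (forall x, exists2 N : set K, nbhs x N &
     exists p : K -> A, forall y z, N y -> N z -> c y z = p z - p y) ->
  exists F : K -> A, locally (fun y z => c y z = F z - F y).
Proof.
move=> /(@simplex_lebesgue (fun N => exists p : K -> A,
  forall y z, N y -> N z -> c y z = p z - p y))[e e0 ec].
(* A step along a segment and a step across to the neighbouring one, each below [e / 2], together
   stay within one good set. *)
have e20 : 0 < e / 2 by rewrite divr_gt0.
have [m m0 me] := fine_mesh e20.
have [[o _]|noK] := pselect (exists x : K, True); last first.
  by exists (fun=> 0) => x; case: noK; exists x.
pose P x i := conv o x (i%:R / m%:R).
exists (fun x => \sum_(i < m) c (P x i) (P x i.+1)) => x.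
exists [set y | `|set_val x - set_val y| < e / 2 / 2].
  by apply: simplex_ball; rewrite divr_gt0.
move=> y z /= xy xz.
have yz : `|set_val y - set_val z| < e / 2.
  rewrite -(subrKA (set_val x)) (le_lt_trans (ler_normD _ _)) //.
  by rewrite [e / 2]splitr ltrD // distrC.
(* The four corners of a rung lie in a common good set, where [c] is a difference of values of [p];
   so the two ways around the rung agree. *)
have ladder i : (i < m)%N -> c (P z i) (P z i.+1) - c (P y i) (P y i.+1) =
    c (P y i.+1) (P z i.+1) - c (P y i) (P z i).
  move=> im; have [N [p cp] eN] := ec (P y i).
  have Nyy : N (P y i) by apply: eN; rewrite subrr normr0.
  have Ny : N (P y i.+1).
    by apply: eN; apply: lt_trans (mesh_step o y me im) _; rewrite ltr_pdivrMr // ltr_pMr // ltr1n.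
  have Nz j : (j <= m)%N -> N (P y j) -> `|set_val (P y i) - set_val (P y j)| < e / 2 -> N (P z j).
    move=> jm _ yij; apply: eN; rewrite -(subrKA (set_val (P y j))) (le_lt_trans (ler_normD _ _)) //.
    by rewrite [e]splitr ltrD // (le_lt_trans (conv_dist _ _ _ (mesh01 jm))).
  have Nzi : N (P z i) by apply: Nz => //; [exact: ltnW|rewrite subrr normr0].
  have Nzj : N (P z i.+1) by apply: Nz => //; exact: mesh_step.
  by rewrite !cp // !opprB addrACA [RHS]addrACA [- _ - _]addrC.
rewrite -sumrB (eq_bigr (fun i : 'I_m => c (P y i.+1) (P z i.+1) - c (P y i) (P z i))); last first.
  by move=> i _; exact: ladder.
rewrite -(big_mkord xpredT (fun i => c (P y i.+1) (P z i.+1) - c (P y i) (P z i))).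
rewrite telescope_sumr // /P mul0r !conv0 divff ?pnatr_eq0 -?lt0n // !conv1.
(* The telescoped sum leaves the term [c o o] at the base end, which is zero because [c] is exact
   near [o]. *)
have [N [p cp] eN] := ec o.
have No : N o by apply: eN; rewrite subrr normr0.
by rewrite (cp o o) // subrr subr0.
Qed.
End SimplexIntegration.

(** * Combinatorial types of configurations *)

Section EdgeRadius.
Variables (R : realType) (d : nat).
Local Notation star := (star R d.+1).
Implicit Types s t : star.

(* The central vertex is counted in edge 0. *)
Definition edge s : 'I_d.+1 := odflt ord0 [pick i | star_at s i != 0].
Definition dist_center s : R := star_at s (edge s).

Lemma edge_eq s i : star_at s i != 0 -> edge s = i.
Proof.
move=> si; rewrite /edge; case: pickP => [j sj|/(_ i)]; last by rewrite si.
exact: star_edge sj si.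
Qed.

Lemma star_at_edge s i : star_at s i = if edge s == i then dist_center s else 0.
Proof.
rewrite /dist_center; case: eqVneq => [->//|ne].
by apply/eqP; apply: contraNT ne => /edge_eq ->.
Qed.

Lemma star_eq s t : edge s = edge t -> dist_center s = dist_center t -> s = t.
Proof. by move=> e r; apply: star_ext => i; rewrite !star_at_edge e r. Qed.

Lemma edge_shrink k s : edge (shrink k s) = edge s.
Proof.
have ne i : (star_at (shrink k s) i != 0) = (star_at s i != 0).
  by rewrite shrink_at mulf_eq0 (gt_eqF (ratio_exp_gt0 _ _)).
by rewrite /edge (eq_pick ne).
Qed.

Lemma dist_center_shrink k s : dist_center (shrink k s) = (4 / 5) ^+ k (edge s) * dist_center s.
Proof. by rewrite /dist_center edge_shrink shrink_at. Qed.

Section Added.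
Variables (n m : nat) (u : FIhom d.+1 n m) (y : 'I_m) (j : 'I_d.+1).
Hypothesis yj : fi_col u y = Some j.

Lemma edge_added : edge (added R u y) = j.
Proof. by apply: edge_eq; rewrite added_at /added_coord yj eqxx gt_eqF // ratio_exp_gt0. Qed.

Lemma dist_center_added : dist_center (added R u y) = (4 / 5) ^+ later u y.
Proof. by rewrite /dist_center edge_added added_at /added_coord yj eqxx. Qed.
End Added.
End EdgeRadius.

Section State.
Variables (R : realType) (d : nat).
Local Notation star := (star R d.+1).

Section Def.
Variables (k n : nat) (g : 'I_k -> 'I_n) (g_inj : injective g) (x : conf n star).

Definition state_col (b : 'I_n) : option 'I_d.+1 :=
  if b \in codom g then None else Some (edge (conf_at x b)).

Definition state_ord (b c : 'I_n) : bool :=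
  [&& b \notin codom g, c \notin codom g, edge (conf_at x b) == edge (conf_at x c) &
    dist_center (conf_at x b) <= dist_center (conf_at x c)].

(* The combinatorial type of a configuration whose particles in the image of g
   are not placed: on each edge, the order of the particles from the centre
   outwards. *)
Definition state : FIhom d.+1 k n.
refine (@FIHom d.+1 k n g state_col state_ord g_inj _ _ _ _ _ _).
- move=> b; rewrite /state_col; case: ifP => [/codomP[i ->]|bN]; split=> //; first by exists i.
  by case=> i gi; rewrite -gi codom_f in bN.
- by move=> b c /and4P[/negPf bN /negPf cN /eqP e _]; rewrite /state_col bN cN e.
- by move=> b; rewrite /state_col /state_ord; case: ifP => //= _ _; rewrite eqxx lexx.
- move=> b c /and4P[_ _ /eqP e bc] /and4P[_ _ _ cb]; apply: (@conf_inj _ _ x).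
  by apply: star_eq => //; apply/le_anti; rewrite bc cb.
- move=> c b e /and4P[bN _ /eqP eb bc] /and4P[_ eN /eqP ee ce]; apply/and4P; split=> //.
    by rewrite eb ee.
  exact: le_trans bc ce.
- move=> b c; rewrite /state_col /state_ord; case: ifP => // _ _; case: ifP => //= _ [->].
  by rewrite eqxx /= le_total.
Defined.
End Def.

Lemma state_eq k n (g : 'I_k -> 'I_n) (g_inj : injective g) (x y : conf n star) :
  (forall b, b \notin codom g -> edge (conf_at x b) = edge (conf_at y b)) ->
  (forall b c, b \notin codom g -> c \notin codom g ->
     edge (conf_at y b) = edge (conf_at y c) ->
     (dist_center (conf_at x b) <= dist_center (conf_at x c)) =
     (dist_center (conf_at y b) <= dist_center (conf_at y c))) ->
  state g_inj x = state g_inj y.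
Proof.
move=> eE rE; apply: FIhom_ext => [//|b|b c] /=.
  by rewrite /state_col; case: ifP => // /negbT /eE ->.
rewrite /state_ord; case bN: (b \notin codom g) => //=; case cN: (c \notin codom g) => //=.
by rewrite !eE //; case: eqP => //= e; exact: rE.
Qed.

(** Scaling keeps the edges and the order of the old particles, and the added ones lie further out,
    in the order recorded by [later]. This is the order of a composite in the category. *)
Lemma state_natural k n m (u : FIhom d.+1 n m) (g : 'I_k -> 'I_n) (g_inj : injective g)
    (h : 'I_k -> 'I_m) (h_inj : injective h) (x : conf n star) :
  (forall i, fi_map u (g i) = h i) ->
  fi_comp u (state g_inj x) = state h_inj (fi_conf R u x).
Proof.
move=> gh.
have im_in b : (fi_map u b \in codom h) = (b \in codom g).
  apply/codomP/codomP => [[i e]|[i ->]]; exists i; last by rewrite gh.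
  by apply: (@fi_inj _ _ _ u); rewrite gh.
have im_out y : fi_pre u y = None -> y \notin codom h.
  move=> yN; apply/negP => /codomP[i e]; move: yN.
  by rewrite e -gh fi_preK.
have inE b y : fi_pre u y = Some b -> [/\ (y \in codom h) = (b \in codom g),
    edge (conf_at (fi_conf R u x) y) = edge (conf_at x b) &
    dist_center (conf_at (fi_conf R u x) y) =
      (4 / 5) ^+ class_size u (edge (conf_at x b)) * dist_center (conf_at x b)].
  move=> yb; rewrite fi_confE /fi_place yb edge_shrink dist_center_shrink; split=> //.
  by rewrite -im_in; move/fi_preP: yb => ->.
have outE y : fi_pre u y = None -> exists j, [/\ fi_col u y = Some j,
    edge (conf_at (fi_conf R u x) y) = j &
    dist_center (conf_at (fi_conf R u x) y) = (4 / 5) ^+ later u y].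
  move=> yN; have [j yj] := added_col yN; exists j.
  by rewrite fi_confE /fi_place yN (edge_added _ yj) (dist_center_added _ yj).
apply: FIhom_ext => [i|y|y z] /=; first exact: gh.
  rewrite /fi_comp_col /state_col /=; case yE: (fi_pre u y) => [b|].
    by have [-> -> _] := inE _ _ yE.
  by have [j [-> -> _]] := outE _ yE; rewrite (negPf (im_out _ yE)).
rewrite /fi_comp_ord /= /state_ord /state_col.
case yE: (fi_pre u y) => [b|]; case zE: (fi_pre u z) => [c|].
- have [-> -> ->] := inE _ _ yE; have [-> -> ->] := inE _ _ zE.
  do 2!case: (_ \in _) => //=; case: eqP => //= ->.
  by rewrite ler_pM2l // ratio_exp_gt0.
- have [-> -> ->] := inE _ _ yE; have [j [zj -> ->]] := outE _ zE.
  rewrite (im_out _ zE) zj; case: ifP => //= _.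
  have -> : (Some (edge (conf_at x b)) == Some j) = (edge (conf_at x b) == j) by [].
  case: eqP => //= ->; apply/esym.
  (* This power separates the scaled old particles from the added ones, whose exponent [later] is
     smaller than the size of the class. *)
  apply: (@le_trans _ _ ((4 / 5) ^+ class_size u j)).
    by rewrite ler_piMr ?star_le1 // ltW // ratio_exp_gt0.
  by rewrite ler_iXn2l ?ratio_gt0 ?ratio_lt1 // ltnW // later_lt.
- have [j [yj -> ->]] := outE _ yE; have [-> -> ->] := inE _ _ zE.
  rewrite (im_out _ yE) /=; case: (_ \in _) => //=; case: eqP => //= <-.
  apply/esym/negbTE; rewrite -ltNge.
  apply: (@le_lt_trans _ _ ((4 / 5) ^+ class_size u j)).
    by rewrite ler_piMr ?star_le1 // ltW // ratio_exp_gt0.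
  by rewrite ltr_iXn2l ?ratio_gt0 ?ratio_lt1 // later_lt.
- have [j [yj -> ->]] := outE _ yE; have [i [zi -> ->]] := outE _ zE.
  rewrite (im_out _ yE) (im_out _ zE) /=; apply/idP/andP => [yz|[/eqP ji]].
    have [_] := fi_ord_col yz; rewrite yj zi => -[->]; split=> //.
    have [->|ne] := eqVneq y z; first exact: lexx.
    by rewrite ler_iXn2l ?ratio_gt0 ?ratio_lt1 // ltnW // later_ord.
  rewrite ler_iXn2l ?ratio_gt0 ?ratio_lt1 // => zy.
  have /orP[//|zy'] : fi_ord u y z || fi_ord u z y by apply: fi_ord_total; rewrite ?yj ?zi ?ji.
  have [->|ne] := eqVneq y z; first by apply: fi_ord_refl; rewrite zi.
  by have := later_ord zy'; rewrite eq_sym ne => /(_ isT); rewrite ltnNge zy.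
Qed.

Variable n : nat.
Implicit Types (x y : conf n star) (a b c : 'I_n).

Lemma widen_ord_inj p q (pq : (p <= q)%N) : injective (widen_ord pq).
Proof. by move=> i j /(congr1 val) /= ij; apply: val_inj. Qed.

Lemma single_inj a : injective (fun _ : 'I_1 => a).
Proof. by move=> i j _; rewrite !ord1. Qed.

Definition state0 x : FIhom d.+1 0 n := state (@widen_ord_inj _ _ (leq0n n)) x.
(** The position of [a] is left out, so the type stays constant while only [a] passes through the
    centre. *)
Definition state1 a x : FIhom d.+1 1 n := state (@single_inj a) x.

Lemma no_mark b : b \notin codom (widen_ord (leq0n n)).
Proof. by apply/negP => /codomP[[]]. Qed.

Lemma single_mark a b : (b \in codom (fun _ : 'I_1 => a)) = (b == a).
Proof. by apply/codomP/eqP => [[_ ->]|->] //; exists ord0. Qed.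

(** In the composite [a] comes first in its colour class, that is, innermost on its edge. *)
Lemma state0_split a x :
  (forall b, b != a -> edge (conf_at x b) = edge (conf_at x a) ->
     dist_center (conf_at x a) <= dist_center (conf_at x b)) ->
  state0 x = fi_comp (state1 a x) (fi_incl 0 (edge (conf_at x a))).
Proof.
move=> inner.
have preE b : fi_pre (state1 a x) b = if b == a then Some ord0 else None.
  case: eqVneq => [->|ba]; first exact/fi_preP.
  by case E: fi_pre => [i|//]; move/fi_preP: E => /= ab; rewrite ab eqxx in ba.
apply: FIhom_ext => [[] //|b|b c] /=.
  rewrite /state_col /fi_comp_col preE (negPf (no_mark b)) /=.
  case: eqVneq => [->|ba] /=; first by rewrite /incl_col.
  by rewrite /state_col single_mark (negPf ba).
rewrite /state_ord /fi_comp_ord !preE !no_mark /=.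
case: (eqVneq b a) => [->|ba]; case: (eqVneq c a) => [->|ca] /=.
- by rewrite eqxx lexx.
- rewrite /incl_col /= /state_col single_mark (negPf ca).
  have -> : (Some (edge (conf_at x a)) == Some (edge (conf_at x c))) =
    (edge (conf_at x a) == edge (conf_at x c)) by [].
  by case: eqP => //= e; apply: inner.
- apply/negP => /andP[/eqP e ra]; have ar := inner b ba e.
  case/eqP: ba; apply: (@conf_inj _ _ x).
  by apply: star_eq => //; apply/le_anti; rewrite ra ar.
- by rewrite /state_ord !single_mark ba ca.
Qed.

(** Only open conditions are imposed: a particle at the centre in [x] may lie on any edge in [y]. *)
Definition near_conf x : set (conf n star) := [set y |
  (forall b i, star_at (conf_at x b) i != 0 -> star_at (conf_at y b) i != 0) /\
  (forall b c i, star_at (conf_at x b) i < star_at (conf_at x c) i ->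
     star_at (conf_at y b) i < star_at (conf_at y c) i)].

Lemma near_confP x : nbhs x (near_conf x).
Proof.
have coord b i : continuous (fun y : conf n star => star_at (conf_at y b) i).
  move=> y; apply: (@continuous_comp _ _ _ (fun y => conf_at y b) (fun s => star_at s i)).
    exact: conf_at_continuous.
  exact: star_at_continuous.
apply: filterI.
  have := @filter_forall _ 'I_n (fun b y => forall i,
    star_at (conf_at x b) i != 0 -> star_at (conf_at y b) i != 0) (nbhs x) _.
  apply=> b; have := @filter_forall _ 'I_d.+1 (fun i y =>
    star_at (conf_at x b) i != 0 -> star_at (conf_at y b) i != 0) (nbhs x) _.
  apply=> i; have [x0|ne] := eqVneq (star_at (conf_at x b) i) 0; first exact: filterE.
  have : \forall y \near x, 0 < star_at (conf_at y b) i.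
    by apply: (coord b i x [set z | 0 < z]); apply: lt_nbhsr; rewrite lt_neqAle eq_sym ne star_ge0.
  by apply: filterS => y y0 _; rewrite gt_eqF.
have := @filter_forall _ 'I_n (fun b y => forall c i,
  star_at (conf_at x b) i < star_at (conf_at x c) i ->
  star_at (conf_at y b) i < star_at (conf_at y c) i) (nbhs x) _.
apply=> b; have := @filter_forall _ 'I_n (fun c y => forall i,
  star_at (conf_at x b) i < star_at (conf_at x c) i ->
  star_at (conf_at y b) i < star_at (conf_at y c) i) (nbhs x) _.
apply=> c; have := @filter_forall _ 'I_d.+1 (fun i y =>
  star_at (conf_at x b) i < star_at (conf_at x c) i ->
  star_at (conf_at y b) i < star_at (conf_at y c) i) (nbhs x) _.
apply=> i; have [le|lt] := leP (star_at (conf_at x c) i) (star_at (conf_at x b) i).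
  exact: filterE.
have [bm mc] := midf_lt lt.
set mid := (_ / 2) in bm mc.
have : \forall y \near x, star_at (conf_at y b) i < mid.
  by apply: (coord b i x [set z | z < mid]); exact: lt_nbhsl.
have : \forall y \near x, mid < star_at (conf_at y c) i.
  by apply: (coord c i x [set z | mid < z]); exact: lt_nbhsr.
by apply: filterS2 => y mc' bm' _; exact: lt_trans bm' mc'.
Qed.
End State.

(** * Particles crossing the centre *)

Section Crossing.
Variables (R : realType) (d : nat).
Local Notation star := (star R d.+1).

(** The components of the differential M(1)^(d+1) -> M(0): the marked particle, inserted innermost,
    passes from the reference edge 0 to edge [j]. The component for edge 0 is zero. *)
Definition unmark n (j : 'I_d.+1) : {additive principal d.+1 1 n -> principal d.+1 0 n} :=
  free_ext (fun h : FIhom d.+1 1 n =>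
    fbasis (fi_comp h (fi_incl 0 j)) - fbasis (fi_comp h (fi_incl 0 ord0))).

Lemma unmark_basis n j (h : FIhom d.+1 1 n) : unmark n j (fbasis h) =
  fbasis (fi_comp h (fi_incl 0 j)) - fbasis (fi_comp h (fi_incl 0 ord0)).
Proof. exact: free_extE. Qed.

Lemma unmark_act n m (u : FIhom d.+1 n m) j z :
  unmark m j (fim_act (principal d.+1 1) u z) = fim_act (principal d.+1 0) u (unmark n j z).
Proof.
move: z; apply: (free_ext_uniq (u := unmark m j \o fim_act (principal d.+1 1) u)
  (v := fim_act (principal d.+1 0) u \o unmark n j)) => h.
rewrite -[LHS]/(unmark m j (fim_act (principal d.+1 1) u (fbasis h))).
rewrite -[RHS]/(fim_act (principal d.+1 0) u (unmark n j (fbasis h))).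
by rewrite principal_act_basis !unmark_basis raddfB !principal_act_basis !fi_compA.
Qed.

Section Conf.
Variable n : nat.
Implicit Types (x y z : conf n star) (a b c : 'I_n) (j : 'I_d.+1).

Definition mark j a y : principal d.+1 1 n :=
  if edge (conf_at y a) == j then fbasis (state1 a y) else 0.

(* The particles entering edge j minus those leaving it, when y and z are
   close to each other. *)
Definition crossing j y z : principal d.+1 1 n :=
  \sum_(a | edge (conf_at y a) != edge (conf_at z a)) (mark j a z - mark j a y).

Lemma near_edge x y b : near_conf x y -> (exists i, star_at (conf_at x b) i != 0) ->
  edge (conf_at y b) = edge (conf_at x b).
Proof. by move=> [xy _] [i xi]; rewrite (edge_eq xi) (edge_eq (xy _ _ xi)). Qed.

Lemma near_state k (g : 'I_k -> 'I_n) (g_inj : injective g) x y : near_conf x y ->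
  (forall b, b \notin codom g -> exists i, star_at (conf_at x b) i != 0) ->
  state g_inj y = state g_inj x.
Proof.
move=> xy off; apply: state_eq => [b bN|b c bN cN e]; first exact: near_edge (off b bN).
rewrite /dist_center !(near_edge xy (off _ bN)) !(near_edge xy (off _ cN)) e.
case: xy => _ /(_ _ _ (edge (conf_at x c))) xy.
(* Strict inequalities persist near [x], and equality for distinct particles on one edge would be a
   collision. *)
have [le|/xy] := leP (star_at (conf_at x b) _); last by rewrite leNgt => ->.
have [->|ne] := eqVneq b c; first exact: lexx.
apply/ltW/xy; rewrite lt_neqAle le andbT; apply: contra ne => /eqP r.
by apply/eqP/(@conf_inj _ _ x); apply: star_eq => //; rewrite /dist_center e.
Qed.

(** At most one particle is at the centre. The others keep their edges near [x], and [a] stays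
    inside all of them, so [state0_split] applies. *)
Lemma near_central x y a : near_conf x y -> (forall i, star_at (conf_at x a) i = 0) ->
  [/\ state1 a y = state1 a x,
      (forall b, b != a -> edge (conf_at y b) = edge (conf_at x b)) &
      state0 y = fi_comp (state1 a x) (fi_incl 0 (edge (conf_at y a)))].
Proof.
move=> xy xa.
have off b : b != a -> exists i, star_at (conf_at x b) i != 0.
  move=> ba; exists (edge (conf_at x b)); apply: contra ba => /eqP xb.
  apply/eqP/(@conf_inj _ _ x); apply: star_ext => i.
  by rewrite xa star_at_edge /dist_center xb if_same.
have s1 : state1 a y = state1 a x.
  by apply: near_state => // b; rewrite single_mark; exact: off.
split=> // [b ba|]; first by apply: near_edge (off b ba).
rewrite -s1; apply: state0_split => b ba e; rewrite /dist_center e.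
apply/ltW; case: (xy) => _; apply; rewrite xa -e (near_edge xy (off b ba)).
rewrite lt_neqAle star_ge0 andbT eq_sym; have [i xi] := off b ba.
by rewrite (edge_eq xi).
Qed.

Lemma near_off x y : near_conf x y -> (forall b, exists i, star_at (conf_at x b) i != 0) ->
  state0 y = state0 x.
Proof. by move=> xy off; apply: near_state. Qed.

Lemma conf_cases x : (exists a, forall i, star_at (conf_at x a) i = 0) \/
  (forall b, exists i, star_at (conf_at x b) i != 0).
Proof.
have [|none] := pselect (exists a, forall i, star_at (conf_at x a) i = 0); first by left.
right=> b; apply: contrapT => bN; apply: none; exists b => i.
by apply: contrapT => /eqP xi; apply: bN; exists i.
Qed.

(** If no particle of [x] is central, nothing changes nearby. Otherwise only the central particle
    [a] can change its edge, [mark j a] is a primitive of the crossings, and inserting [a] recovers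
    the full type. *)
Lemma crossing_local x : exists p : 'I_d.+1 -> conf n star -> principal d.+1 1 n,
  forall y z, near_conf x y -> near_conf x z ->
    (forall j, crossing j y z = p j z - p j y) /\
    fbasis (state0 z) - fbasis (state0 y) = \sum_j unmark n j (crossing j y z).
Proof.
have [[a xa]|off] := conf_cases x; last first.
  exists (fun _ _ => 0) => y z xy xz.
  have c0 j : crossing j y z = 0.
    by rewrite /crossing big_pred0 // => b; rewrite !(near_edge _ (off b)) // eqxx.
  split=> [j|]; first by rewrite c0 subrr.
  by rewrite (near_off xy off) (near_off xz off) subrr big1 // => j _; rewrite c0 raddf0.
exists (fun j y => mark j a y) => y z xy xz.
have [sy ey s0y] := near_central xy xa; have [sz ez s0z] := near_central xz xa.
have cE j : crossing j y z = mark j a z - mark j a y.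
  rewrite /crossing; have [e|ne] := eqVneq (edge (conf_at y a)) (edge (conf_at z a)).
    rewrite big_pred0; first by rewrite /mark e sy sz subrr.
    by move=> b; have [->|ba] := eqVneq b a; [rewrite e eqxx|rewrite ey // ez // eqxx].
  rewrite (bigD1 a) //= big_pred0 ?addr0 // => b.
  by case: (eqVneq b a) => [_|ba]; rewrite ?andbF // ey // ez // eqxx.
split=> //; rewrite s0y s0z (eq_bigr (fun j => unmark n j (mark j a z) - unmark n j (mark j a y))).
  rewrite sumrB.
  (* Only the edge occupied by [a] contributes; the reference term for edge 0 cancels in the
     difference of two such sums. *)
  have mE w : state1 a w = state1 a x -> \sum_j unmark n j (mark j a w) =
      fbasis (fi_comp (state1 a x) (fi_incl 0 (edge (conf_at w a)))) -
      fbasis (fi_comp (state1 a x) (fi_incl 0 ord0)).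
    move=> sw; rewrite (bigD1 (edge (conf_at w a))) //= /mark eqxx sw unmark_basis.
    by rewrite big1 ?addr0 // => j /negPf; rewrite eq_sym => ->; exact: raddf0.
  by rewrite !mE // opprB addrA subrK.
by move=> j _; rewrite cE raddfB.
Qed.
End Conf.

Lemma crossing_natural n m (u : FIhom d.+1 n m) j (y z : conf n star) :
  crossing j (fi_conf R u y) (fi_conf R u z) = fim_act (principal d.+1 1) u (crossing j y z).
Proof.
have eE (x : conf n star) a : edge (conf_at (fi_conf R u x) (fi_map u a)) = edge (conf_at x a).
  by rewrite fi_confE /fi_place fi_preK edge_shrink.
(* An added particle has the same position in both configurations, so only particles in the image of
   [u] contribute. *)
rewrite /crossing raddf_sum (reindex_omap (fi_map u) (fi_pre u)) /=; last first.
  move=> c; rewrite !fi_confE /fi_place; case cE: (fi_pre u c) => [a|]; last by rewrite eqxx.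
  by move/fi_preP: cE => <-.
apply: eq_big => [a|a _]; first by rewrite fi_preK eqxx andbT !eE.
have mE x : mark j (fi_map u a) (fi_conf R u x) = fim_act (principal d.+1 1) u (mark j a x).
  rewrite /mark eE; case: ifP => _; last by rewrite raddf0.
  by rewrite principal_act_basis /state1 (state_natural _ (@single_inj _ (fi_map u a))).
by rewrite !mE -raddfB.
Qed.
End Crossing.

(** * From singular chains to combinatorial types *)

Section SimplexPoint.
Variable R : realType.

Lemma point_in : simplex R 0 (const_mx 1).
Proof. by split=> [i|]; rewrite ?big_ord1 mxE ?ler01. Qed.

Definition point : simplex R 0 := exist _ (const_mx 1) (mem_set point_in).

(** The two face maps omit the vertices [i] and [lift i j], so a single vertex of the triangle
    remains. *)
Lemma face_face_point (i : 'I_3) (j : 'I_2) (l : 'I_3) :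
  set_val (face R i (face R j point)) 0 l = ((l != i) && (l != lift i j))%:R.
Proof.
rewrite set_valE /= mxE; case: unliftP => [l' ->|->]; last by rewrite eqxx.
rewrite eq_sym neq_lift /= (inj_eq lift_inj) set_valE /= mxE.
by case: unliftP => [l'' ->|->]; rewrite ?eqxx // eq_sym neq_lift mxE.
Qed.

Lemma face_face_eq (i i' : 'I_3) (j j' : 'I_2) : lift i j = i' -> lift i' j' = i ->
  face R i (face R j point) = face R i' (face R j' point).
Proof.
move=> e e'; apply: val_inj; apply/rowP => l.
by rewrite -set_valE !face_face_point e e' andbC.
Qed.
End SimplexPoint.

Lemma cts_nbhs (X Y : topologicalType) (f : continuousType X Y) x (N : set Y) :
  nbhs (f x) N -> nbhs x (f @^-1` N).
Proof. by move=> fN; have := @cts_fun _ _ f x; apply. Qed.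

Lemma ccompE (X Y Z : topologicalType) (g : continuousType Y Z) (f : continuousType X Y) x :
  ccomp g f x = g (f x).
Proof. by []. Qed.

Lemma subr_swap (V : zmodType) (a b c e : V) : a - b = c - e -> c - a = e - b.
Proof. by move/eqP; rewrite subr_eq => /eqP ->; rewrite opprD opprB addrA [c + _]addrC subrK. Qed.

Section Transport.
Variables (R : realType) (d n : nat).
Local Notation conf := (conf n (star R d.+1)).

Lemma crossing_primitive k (s : continuousType (simplex R k) conf) (j : 'I_d.+1) :
  exists F : simplex R k -> principal d.+1 1 n,
    locally (fun x y => crossing j (s x) (s y) = F y - F x).
Proof.
apply: locally_primitive => x; exists (s @^-1` near_conf (s x)).
  apply: cts_nbhs; exact: near_confP.
have [p pE] := crossing_local (s x); exists (p j \o s) => y z xy xz.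
by have [-> _] := pE _ _ xy xz.
Qed.

(** The total crossing from [x] to [y] inside the simplex; the choice of the primitive is immaterial
    by [transportE]. *)
Definition transport k (s : continuousType (simplex R k) conf) (j : 'I_d.+1)
    (x y : simplex R k) : principal d.+1 1 n :=
  let F := projT1 (cid (crossing_primitive s j)) in F y - F x.

(** Two primitives of the same local cocycle differ by a locally constant, hence constant,
    function. *)
Lemma transportE k (s : continuousType (simplex R k) conf) j F x y :
  locally (fun x y => crossing j (s x) (s y) = F y - F x) -> transport s j x y = F y - F x.
Proof.
rewrite /transport; case: cid => G /= GP FP.
have : G x - F x = G y - F y.
  apply: (locally_constant (G := fun x => G x - F x)) => z.
  have [N zN NG] := GP z; have [M zM MF] := FP z.
  exists (N `&` M); first exact: filterI.
  by move=> a b [Na Ma] [Nb Mb]; apply/esym/subr_swap; rewrite -NG // MF.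
exact: subr_swap.
Qed.

Lemma transport_locally k (s : continuousType (simplex R k) conf) j x0 :
  locally (fun x y => crossing j (s x) (s y) = transport s j x0 y - transport s j x0 x).
Proof.
rewrite /transport; case: cid => F /= FP x; have [N xN NF] := FP x; exists N => // y z Ny Nz.
by rewrite NF // opprB addrA subrK.
Qed.

Lemma transport_comp k l (s : continuousType (simplex R l) conf)
    (f : continuousType (simplex R k) (simplex R l)) j x y :
  transport (ccomp s f) j x y = transport s j (f x) (f y).
Proof.
pose F := projT1 (cid (crossing_primitive s j)).
have FP : locally (fun x y => crossing j (s x) (s y) = F y - F x).
  by rewrite /F; case: cid.
rewrite (transportE (F := F)) // (transportE (F := F \o f)) // => z.
have [N zN NF] := FP (f z); exists (f @^-1` N); first exact: cts_nbhs.
by move=> a b; exact: NF.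
Qed.

(** By [crossing_local] both sides have the same local increments, so their difference [G] is
    locally constant. *)
Lemma transport_state k (s : continuousType (simplex R k) conf) x y :
  fbasis (state0 (s y)) - fbasis (state0 (s x)) =
  \sum_j unmark n j (transport s j x y).
Proof.
pose G z := fbasis (state0 (s z)) - \sum_j unmark n j (transport s j x z).
have GE : G x = G y.
  apply: locally_constant => z.
  have [p pE] := crossing_local (s z).
  have tloc j : exists N : set (simplex R k), nbhs z N /\ forall a b, N a -> N b ->
      crossing j (s a) (s b) = transport s j x b - transport s j x a.
    by have [N zN NE] := @transport_locally _ s j x z; exists N.
  have [N NP] := choice tloc.
  exists ([set a | forall j, N j a] `&` s @^-1` near_conf (s z)).
    apply: filterI; last by apply: cts_nbhs; exact: near_confP.
    have := @filter_forall _ 'I_d.+1 (fun j a => N j a) (nbhs z) _.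
    by apply=> j; case: (NP j).
  move=> a b [Na sa] [Nb sb]; have [_ e] := pE _ _ sa sb.
  apply/esym/subr_swap; rewrite e -sumrB; apply: eq_bigr => j _.
  have [_ /(_ a b (Na j) (Nb j)) ->] := NP j; exact/esym/raddfB.
have := subr_swap GE; rewrite [X in _ = _ - X]big1 ?subr0 // => j _.
by rewrite /transport subrr raddf0.
Qed.
End Transport.

Lemma boundary1_basis (R : realType) (X : topologicalType) (s : singular R X 1) :
  boundary R X 1 (fbasis s) =
  fbasis (ccomp s (face R ord0)) - fbasis (ccomp s (face R ord_max)).
Proof.
rewrite boundaryE !big_ord_recl big_ord0 addr0 expr0 mulr1z.
congr (_ + _); rewrite expr1 mulrN1z; congr (- fbasis (ccomp s (face R _))).
exact: val_inj.
Qed.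

(** * The map from singular chains to types and crossings *)

Section ChainMaps.
Variables (R : realType) (d : nat).
Local Notation star := (star R d.+1).

Section Conf.
Variable n : nat.
Local Notation conf := (conf n star).

(** Face [ord_max] is the initial vertex and face [ord0] the final one, in accordance with the signs
    in [boundary1_basis]. *)
Definition crossing_chain (j : 'I_d.+1) : {additive chain R conf 1 -> principal d.+1 1 n} :=
  free_ext (fun s : singular R conf 1 =>
    transport s j (face R ord_max (point R)) (face R ord0 (point R))).

Lemma crossing_chain_basis j (s : singular R conf 1) : crossing_chain j (fbasis s) =
  transport s j (face R ord_max (point R)) (face R ord0 (point R)).
Proof. exact: free_extE. Qed.

Definition state_chain : {additive chain R conf 0 -> principal d.+1 0 n} :=
  free_ext (fun s : singular R conf 0 => fbasis (state0 (s (point R)))).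

Lemma state_chain_basis (s : singular R conf 0) :
  state_chain (fbasis s) = fbasis (state0 (s (point R))).
Proof. exact: free_extE. Qed.

(** The square of a chain map in degrees 1 and 0, with [unmark] as the differential on the
    combinatorial side. *)
Lemma state_boundary c :
  state_chain (boundary R conf 1 c) = \sum_j unmark n j (crossing_chain j c).
Proof.
move: c; pose v c : principal d.+1 0 n := \sum_j unmark n j (crossing_chain j c).
have v_add : GRing.zmod_morphism v.
  by move=> x y; rewrite /v -sumrB; apply: eq_bigr => j _; rewrite !raddfB.
pose vA : {additive chain R conf 1 -> principal d.+1 0 n} :=
  HB.pack v (GRing.isZmodMorphism.Build _ _ v v_add).
apply: (free_ext_uniq (u := state_chain \o boundary R conf 1) (v := vA)) => s.
rewrite -[LHS]/(state_chain (boundary R conf 1 (fbasis s))) boundary1_basis raddfB.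
rewrite !state_chain_basis !ccompE.
transitivity (\sum_j unmark n j (transport s j (face R ord_max (point R)) (face R ord0 (point R)))).
  exact: transport_state.
by apply: eq_bigr => j _; rewrite crossing_chain_basis.
Qed.

(** One primitive [F] on the triangle serves for its three edges, so the sum around the boundary
    telescopes. *)
Lemma crossing_boundary j c : crossing_chain j (boundary R conf 2 c) = 0.
Proof.
move: c; apply: (free_ext_uniq (u := crossing_chain j \o boundary R conf 2) (v := \0)) => s.
rewrite -[LHS]/(crossing_chain j (boundary R conf 2 (fbasis s))) boundaryE raddf_sum.
pose F := projT1 (cid (crossing_primitive s j)).
have FE i : crossing_chain j (fbasis (ccomp s (face R i))) =
    F (face R i (face R ord0 (point R))) - F (face R i (face R ord_max (point R))).
  by rewrite crossing_chain_basis transport_comp.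
rewrite !big_ord_recl big_ord0 addr0 !raddfMz !FE expr0 mulr1z expr1 mulrN1z sqrrN expr1n mulr1z.
have e01 : face R (lift ord0 ord0) (face R ord0 (point R)) = face R ord0 (face R ord0 (point R)).
  by apply: face_face_eq; apply: val_inj.
have e02 : face R (lift ord0 (lift ord0 ord0)) (face R ord0 (point R)) =
    face R ord0 (face R ord_max (point R)).
  by apply: face_face_eq; apply: val_inj.
have e12 : face R (lift ord0 (lift ord0 ord0)) (face R ord_max (point R)) =
    face R (lift ord0 ord0) (face R ord_max (point R)).
  by apply: face_face_eq; apply: val_inj.
by rewrite e01 e02 e12 opprB [X in _ + X]addrC !subrKA subrr.
Qed.
End Conf.

Lemma crossing_chain_natural n m (u : FIhom d.+1 n m) j c :
  crossing_chain m j (chain_map R (fi_conf R u) 1 c) =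
  fim_act (principal d.+1 1) u (crossing_chain n j c).
Proof.
move: c; apply: (free_ext_uniq (u := crossing_chain m j \o chain_map R (fi_conf R u) 1)
  (v := fim_act (principal d.+1 1) u \o crossing_chain n j)) => s.
rewrite -[LHS]/(crossing_chain m j (chain_map R (fi_conf R u) 1 (fbasis s))) chain_mapE.
rewrite -[RHS]/(fim_act (principal d.+1 1) u (crossing_chain n j (fbasis s))).
rewrite !crossing_chain_basis.
pose F := projT1 (cid (crossing_primitive s j)).
have FP : locally (fun x y => crossing j (s x) (s y) = F y - F x) by rewrite /F; case: cid.
rewrite (transportE (F := F)) // raddfB.
rewrite (transportE (F := fim_act (principal d.+1 1) u \o F)) // => x.
have [N xN NF] := FP x; exists N => // y z Ny Nz.
by rewrite crossing_natural NF // raddfB.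
Qed.

Lemma state_chain_natural n m (u : FIhom d.+1 n m) c :
  state_chain m (chain_map R (fi_conf R u) 0 c) =
  fim_act (principal d.+1 0) u (state_chain n c).
Proof.
move: c; apply: (free_ext_uniq (u := state_chain m \o chain_map R (fi_conf R u) 0)
  (v := fim_act (principal d.+1 0) u \o state_chain n)) => s.
rewrite -[LHS]/(state_chain m (chain_map R (fi_conf R u) 0 (fbasis s))) chain_mapE.
rewrite -[RHS]/(fim_act (principal d.+1 0) u (state_chain n (fbasis s))).
rewrite !state_chain_basis principal_act_basis; congr fbasis; apply/esym.
by apply: state_natural => -[].
Qed.

Lemma crossing_boundaries n j (z : cycle R (conf n star) 1) :
  boundaries R (conf n star) 1 z ->
  (crossing_chain n j \o (\val : cycle R (conf n star) 1 -> chain R (conf n star) 1)) z = 0.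
Proof. by move=> [c zc]; rewrite /= zc crossing_boundary. Qed.

Definition crossing_homology n j : {additive homology R (conf n star) 1 -> principal d.+1 1 n} :=
  quo_lift (@crossing_boundaries n j).

Lemma crossing_homologyE n j (z : cycle R (conf n star) 1) :
  crossing_homology n j (quo_pi _ z) = crossing_chain n j (cycle_val z).
Proof. exact: quo_liftE. Qed.

Lemma crossing_homology_natural j n m (u : FIhom d.+1 n m) (x : conf_homology R d.+1 1 n) :
  crossing_homology m j (fim_act (conf_homology R d.+1 1) u x) =
  fim_act (principal d.+1 1) u (crossing_homology n j x).
Proof.
have [z ->] := quo_pi_surj x.
have -> : fim_act (conf_homology R d.+1 1) u (quo_pi _ z) =
  quo_pi (boundaries R (conf m star) 1) (cycle_map R (fi_conf R u) 1 z) by exact: homology_mapE.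
by rewrite !crossing_homologyE crossing_chain_natural.
Qed.

Definition crossing_mor j : FImor (conf_homology R d.+1 1) (principal d.+1 1) :=
  FIMor (@crossing_homology_natural j).

Lemma unmark_crossing_homology n (x : conf_homology R d.+1 1 n) :
  \sum_j unmark n j (crossing_mor j n x) = 0.
Proof.
have [z ->] := quo_pi_surj x.
under eq_bigr => j _ do rewrite -[crossing_mor j n _]/(crossing_homology n j _) crossing_homologyE.
by rewrite -state_boundary; have /eqP-> := cycleP z; rewrite raddf0.
Qed.
End ChainMaps.

(** * Connectedness of the configuration spaces *)

Section PointHomology.
Variable R : realType.

Section Space.
Variable X : topologicalType.

Definition cst_simplex_fun (x : X) : simplex R 0 -> X := cst x.

HB.instance Definition _ x :=
  isContinuous.Build _ _ (cst_simplex_fun x) (@cst_continuous _ _ x).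

Definition cst_simplex x : singular R X 0 := cst_simplex_fun x.

Definition point_chain (x : X) : chain R X 0 := fbasis (cst_simplex x).

Definition homologous (x y : X) : Prop :=
  exists e, boundary R X 1 e = point_chain y - point_chain x.

Lemma homologous_refl x : homologous x x.
Proof. by exists 0; rewrite raddf0 subrr. Qed.

Lemma homologous_sym x y : homologous x y -> homologous y x.
Proof. by move=> [e eE]; exists (- e); rewrite raddfN eE opprB. Qed.

Lemma homologous_trans y x z : homologous x y -> homologous y z -> homologous x z.
Proof.
move=> [e eE] [f fE]; exists (e + f); rewrite raddfD eE fE addrC.
by rewrite addrA subrK.
Qed.
End Space.

Lemma chain_map_point (X Y : topologicalType) (f : continuousType X Y) x :
  chain_map R f 0 (point_chain x) = point_chain (f x).
Proof. by rewrite /point_chain chain_mapE; congr fbasis; exact/continuousEP. Qed.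

Lemma homologous_map (X Y : topologicalType) (f : continuousType X Y) x y :
  homologous x y -> homologous (f x) (f y).
Proof.
move=> [e eE]; exists (chain_map R f 1 e).
by rewrite chain_map_boundary eE raddfB !chain_map_point.
Qed.
End PointHomology.

(** * Straight-line paths of configurations *)

Section StraightLine.
Variables (R : realType) (d n : nat).
Local Notation star := (star R d).
Variables x y : conf n star.

(** Coordinatewise interpolation stays in the star because, by [same_edge], the two positions of a
    particle lie on a common edge. *)
Definition on_line (t : R) (a : 'I_n) (i : 'I_d) : R :=
  (1 - t) * star_at (conf_at x a) i + t * star_at (conf_at y a) i.

Hypothesis same_edge : forall a i i',
  star_at (conf_at x a) i != 0 \/ star_at (conf_at y a) i != 0 ->
  star_at (conf_at x a) i' != 0 \/ star_at (conf_at y a) i' != 0 -> i = i'.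
Hypothesis no_collision : forall t a b, 0 <= t <= 1 -> a != b ->
  exists i, on_line t a i != on_line t b i.

Let time (s : simplex R 1) : R := (set_val s : 'rV[R]_2) 0 ord_max.

Lemma time01 s : 0 <= time s <= 1.
Proof.
have [s0 s1] := simplex_in s; rewrite /time s0 /= -s1 big_ord_recl big_ord1 /=.
have -> : (set_val s : 'rV[R]_2) 0 (lift ord0 ord0) = (set_val s : 'rV[R]_2) 0 ord_max.
  by congr (_ _ _); apply: val_inj.
by rewrite lerDr.
Qed.

Lemma on_line01 s a i : 0 <= on_line (time s) a i <= 1.
Proof.
have /andP[t0 t1] := time01 s; rewrite /on_line.
have := star_ge0 (conf_at x a) i; have := star_le1 (conf_at x a) i.
have := star_ge0 (conf_at y a) i; have := star_le1 (conf_at y a) i.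
move: (star_at _ _) (star_at _ _) (time s) t0 t1 => p q t *; apply/andP; split; nra.
Qed.

Lemma on_line_edge s a i i' :
  on_line (time s) a i != 0 -> on_line (time s) a i' != 0 -> i = i'.
Proof.
have ne i0 : on_line (time s) a i0 != 0 ->
    star_at (conf_at x a) i0 != 0 \/ star_at (conf_at y a) i0 != 0.
  rewrite /on_line; case: (eqVneq (star_at (conf_at x a) i0) 0) => [->|]; last by left.
  case: (eqVneq (star_at (conf_at y a) i0) 0) => [->|]; last by right.
  by rewrite !mulr0 addr0 eqxx.
by move=> /ne h /ne h'; exact: same_edge h h'.
Qed.

Definition line_star s a : star := mk_star (on_line01 s a) (@on_line_edge s a).

Lemma line_star_inj s : injective (line_star s).
Proof.
move=> a b ab; apply/eqP/negPn/negP => ne.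
have [i] := no_collision (time01 s) ne.
by have := congr1 (fun z : star => star_at z i) ab; rewrite !star_atE => ->; rewrite eqxx.
Qed.

Definition line_fun (s : simplex R 1) : conf n star := mk_conf (@line_star_inj s).

Lemma line_at s a i : star_at (conf_at (line_fun s) a) i = on_line (time s) a i.
Proof. by rewrite conf_atE star_atE. Qed.

Lemma line_continuous : continuous line_fun.
Proof.
apply: continuous_conf => a; apply: continuous_star => i.
have -> : (fun s => star_at (conf_at (line_fun s) a) i) = (fun s => on_line (time s) a i).
  by apply/funext => s; exact: line_at.
have tc : continuous time.
  move=> s; apply: (@continuous_comp _ _ _ set_val (fun v : 'rV[R]_2 => v 0 ord_max)).
    exact: continuous_set_val.
  exact: continuous_coord.
have gc : continuous (fun t : R => on_line t a i).
  move=> t; apply: cvgD; first (apply: cvgM; last exact: cvg_cst).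
    by apply: cvgB; [exact: cvg_cst|exact: cvg_id].
  by apply: cvgM; [exact: cvg_id|exact: cvg_cst].
by move=> s; apply: (@continuous_comp _ _ _ time (fun t => on_line t a i)); [exact: tc|exact: gc].
Qed.

HB.instance Definition _ := isContinuous.Build _ _ line_fun line_continuous.

Lemma homologous_line : homologous R x y.
Proof.
pose l : singular R (conf n star) 1 := line_fun.
exists (fbasis l); rewrite boundary1_basis.
(* The 0-simplex has one point, so a singular 0-simplex is determined by its value there. *)
have ptE (p q : singular R (conf n star) 0) : p (point R) = q (point R) -> fbasis p = fbasis q.
  move=> pq; congr fbasis; apply/continuousEP => z.
  suff -> : z = point R by [].
  apply: val_inj; apply/rowP => i; have [_ z1] := simplex_in z.
  by rewrite -set_valE ord1 mxE -z1 big_ord1.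
have tE (i : 'I_2) : time (face R i (point R)) = (i == ord0)%:R.
  rewrite /time set_valE /= mxE; case: unliftP => [k|] iE.
    rewrite set_valE /= mxE; move: iE; case: (unliftP ord0 i) => [k'|] -> //.
    by rewrite (ord1 k') (ord1 k) => /(congr1 val).
  by rewrite -iE.
congr (_ - _); apply: ptE; rewrite ccompE; apply: conf_ext => a; apply: star_ext => i;
  rewrite line_at tE /on_line.
  by rewrite eqxx subrr mul0r add0r mul1r.
by rewrite subr0 mul1r mul0r addr0.
Qed.
End StraightLine.

Section Connected.
Variable R : realType.
Local Notation star := (star R 3).
Local Notation add q := (fi_conf R (@add_point 3 _ q)).

Lemma zero01 (i : 'I_3) : 0 <= (0 : R) <= 1. Proof. by rewrite lexx ler01. Qed.

Lemma zero_edge (i j : 'I_3) : (0 : R) != 0 -> (0 : R) != 0 -> i = j.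
Proof. by rewrite eqxx. Qed.

Definition center : star := mk_star zero01 zero_edge.

Lemma conf_inhabited n : exists x : conf n star, True.
Proof.
elim: n => [|n [x _]]; last by exists (add (ord0, ord0) x).
have inj : injective (fun i : 'I_0 => center) by case.
by exists (mk_conf inj).
Qed.

Lemma add_at_self m (q : 'I_3 * 'I_m.+1) (x : conf m star) i :
  star_at (conf_at (add q x) q.2) i =
  if i == q.1 then (4 / 5) ^+ later (add_point q) q.2 else 0.
Proof.
rewrite fi_confE /fi_place add_point_pre_self added_at /added_coord add_point_col_self.
by have -> : (Some q.1 == Some i) = (i == q.1) by rewrite eq_sym.
Qed.

Lemma add_at m (q : 'I_3 * 'I_m.+1) (x : conf m star) b i :
  star_at (conf_at (add q x) (fintype.lift q.2 b)) i =
  (4 / 5) ^+ class_size (add_point q) i * star_at (conf_at x b) i.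
Proof. by rewrite fi_confE /fi_place add_point_pre shrink_at. Qed.

Lemma add_at_lt m (q : 'I_3 * 'I_m.+1) (x : conf m star) b :
  star_at (conf_at (add q x) (fintype.lift q.2 b)) q.1 < star_at (conf_at (add q x) q.2) q.1.
Proof.
rewrite add_at add_at_self eqxx.
apply: (@le_lt_trans _ _ ((4 / 5) ^+ class_size (add_point q) q.1)).
  by rewrite ler_piMr ?star_le1 // ltW // ratio_exp_gt0.
by rewrite ltr_iXn2l ?ratio_gt0 ?ratio_lt1 // later_lt // add_point_col_self.
Qed.

(** The outermost particle of edge [q.1] moves to the leaf while the others contract as in the
    target; [x'] is [x] without that particle. All order relations are kept, so the straight path
    has no collision. *)
Lemma slide m (x : conf m.+1 star) (q : 'I_3 * 'I_m.+1) :
  star_at (conf_at x q.2) q.1 != 0 ->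
  (forall b, b != q.2 -> star_at (conf_at x b) q.1 < star_at (conf_at x q.2) q.1) ->
  exists x', homologous R x (add q x').
Proof.
case: q => j a /= aj outer.
have inj : injective (fun b : 'I_m => conf_at x (fintype.lift a b)).
  by move=> b c /conf_inj /lift_inj.
pose x' : conf m star := mk_conf inj; exists x'.
have x'E b : conf_at x' b = conf_at x (fintype.lift a b) by rewrite conf_atE.
have zb b i : star_at (conf_at (add (j, a) x') (fintype.lift a b)) i =
    (4 / 5) ^+ class_size (add_point (j, a)) i * star_at (conf_at x (fintype.lift a b)) i.
  by rewrite (@add_at _ (j, a)) x'E.
have za := @add_at_self _ (j, a) x'; have zlt := @add_at_lt _ (j, a) x'.
have za0 : 0 < star_at (conf_at (add (j, a) x') a) j by rewrite za eqxx ratio_exp_gt0.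
have xa0 : 0 < star_at (conf_at x a) j by rewrite lt_neqAle eq_sym aj star_ge0.
have ne b i : star_at (conf_at x b) i != 0 \/ star_at (conf_at (add (j, a) x') b) i != 0 ->
    star_at (conf_at x b) i != 0.
  case=> //; case: (unliftP a b) => [b'|] ->; first by rewrite zb mulf_eq0 negb_or => /andP[].
  by rewrite za /=; case: (eqVneq i j) => [->|]; rewrite ?eqxx.
apply: homologous_line => [b i i' /ne h /ne h'|t b c t01 bc]; first exact: star_edge h h'.
have /andP[t0 t1] := t01.
(* The sliding particle stays strictly outside the others on its edge, at both ends and hence at all
   times. *)
have against b' : on_line x (add (j, a) x') t (fintype.lift a b') j < on_line x (add (j, a) x') t a j.
  have h1 : star_at (conf_at x (fintype.lift a b')) j < star_at (conf_at x a) j.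
    by apply: outer; rewrite eq_sym neq_lift.
  have h2 := zlt b'; rewrite /= in h2; rewrite /on_line.
  have [->|tn0] := eqVneq t 0; first by rewrite subr0 !mul1r !mul0r !addr0.
  have tgt0 : 0 < t by rewrite lt_neqAle eq_sym tn0.
  by rewrite ler_ltD // ?ltr_pM2l // ler_wpM2l ?subr_ge0 // ltW.
case: (unliftP a b) (unliftP a c) bc => [b'|] -> [c'|] -> bc.
- have [i xi] : exists i, star_at (conf_at x (fintype.lift a b')) i !=
      star_at (conf_at x (fintype.lift a c')) i.
    apply: contrapT => none; case/eqP: bc; apply: (@conf_inj _ _ x); apply: star_ext => i.
    by apply: contrapT => /eqP xi; apply: none; exists i.
  exists i; rewrite /on_line !zb !mulrA -!mulrDl; apply: contra xi => /eqP.
  (* For the other particles each coordinate is multiplied by a common positive factor, so distinct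
     positions stay distinct. *)
  have f0 : 1 - t + t * (4 / 5) ^+ class_size (add_point (j, a)) i != 0.
    rewrite gt_eqF //; have := ratio_exp_gt0 R (class_size (add_point (j, a)) i).
    have [->|tn0 r0] := eqVneq t 0; first by rewrite subr0 mul0r addr0 ltr01.
    have tgt0 : 0 < t by rewrite lt_neqAle eq_sym tn0.
    by rewrite ltr_wpDl ?subr_ge0 // mulr_gt0.
  by move/(mulfI f0) ->.
- by exists j; rewrite lt_eqF.
- by exists j; rewrite gt_eqF.
- by rewrite eqxx in bc.
Qed.

(** Of two particles at least one is off the centre; on its edge take the outermost particle. *)
Lemma slide_exists m (x : conf m.+2 star) : exists q x', homologous R x (add q x').
Proof.
have [b0 b0P] : exists b, edge (conf_at x b) = edge (conf_at x b) /\
    star_at (conf_at x b) (edge (conf_at x b)) != 0.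
  apply: contrapT => none.
  have z b i : star_at (conf_at x b) i = 0.
    rewrite star_at_edge; case: ifP => // _; rewrite /dist_center.
    by apply: contrapT => /eqP h; apply: none; exists b.
  have : (ord0 : 'I_m.+2) = ord_max by apply: (@conf_inj _ _ x); apply: star_ext => i; rewrite !z.
  by move/(congr1 val).
pose j := edge (conf_at x b0).
have [a _ amax0] := @arg_maxP _ _ _ b0 xpredT (fun b => star_at (conf_at x b) j) isT.
have amax b : star_at (conf_at x b) j <= star_at (conf_at x a) j := amax0 b isT.
have a0 : star_at (conf_at x a) j != 0.
  have h := amax b0; rewrite gt_eqF // (lt_le_trans _ h) // lt_neqAle eq_sym star_ge0 andbT.
  by case: b0P.
exists (j, a); apply: slide => //= b ba; rewrite lt_neqAle amax andbT.
apply: contra ba => /eqP e; apply/eqP/(@conf_inj _ _ x).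
have b1 : star_at (conf_at x b) j != 0 by rewrite e.
by apply: star_eq; rewrite /dist_center (edge_eq a0) (edge_eq b1).
Qed.

(* By induction, the class of [add q x'] depends only on q; it does not depend
   on q either, because operations of distinct colours commute and there are
   three colours. *)
Lemma conf_connected n (x y : conf n star) : homologous R x y.
Proof.
elim: n x y => [|[|m] IHm] x y.
- by suff -> : x = y; [exact: homologous_refl|apply: conf_ext => -[]].
- have inj : injective (fun _ : 'I_1 => center) by move=> a b _; rewrite !ord1.
  (* A single particle moves along its edge to the centre. *)
  have toc z : homologous R z (mk_conf inj : conf 1 star).
    apply: homologous_line => [a i i'|t a b _]; last by rewrite !ord1 eqxx.
    rewrite conf_atE !star_atE eqxx => -[h|//] [h'|//]; exact: star_edge h h'.
  by apply: (homologous_trans (toc x)); apply: homologous_sym.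
(* By induction [x1] and [x2] may be replaced by [w] with the other point added, and then the two
   configurations coincide. *)
have step (j i : 'I_3) (a b : 'I_m.+2) (x1 x2 : conf m.+1 star) : j != i -> a != b ->
    homologous R (add (j, a) x1) (add (i, b) x2).
  move=> ji ab; have [b' bE _] := unlift_some ab.
  have [a' aE _] : { c | a = fintype.lift b c & unlift b a = Some c }.
    by apply: unlift_some; rewrite eq_sym.
  have [w _] := conf_inhabited m.
  apply: (@homologous_trans _ _ (add (j, a) (add (i, b') w))); first exact: homologous_map.
  have ij : i != j by rewrite eq_sym.
  have -> : add (j, a) (add (i, b') w) = add (i, b) (add (j, a') w).
    by have := congr1 (fun u => fi_conf R u w) (add_point_commute ij aE bE); rewrite !fi_conf_comp.
  exact: homologous_map.
have [q [x' xq]] := slide_exists x; have [r [y' yr]] := slide_exists y.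
apply: (homologous_trans xq); apply: homologous_trans (homologous_sym yr).
have other (i j : 'I_3) : exists k : 'I_3, (i != k) && (k != j).
  by case: i j => [[|[|[|?]]] ?] [[|[|[|?]]] ?] //;
    solve [by exists (@Ordinal 3 0 isT)|by exists (@Ordinal 3 1 isT)|by exists (@Ordinal 3 2 isT)].
case: q r xq yr => [j a] [i b] _ _.
(* The cases not covered by [step] pass through other colours: one intermediate position [c] if
   [a = b], and two intermediate colours if the positions differ but the colours agree. *)
have [ab|ab] := eqVneq a b.
  have [c ac] : exists c, a != c.
    by exists (if a == ord0 then ord_max else ord0); case: (eqVneq a ord0) => [->|].
  have [k /andP[jk ki]] := other j i.
  apply: (homologous_trans (step _ _ _ _ _ x' jk ac)); apply: step => //.
  by rewrite -ab eq_sym.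
have [ji|ji] := eqVneq j i; last exact: step.
have [k /andP[jk _]] := other j j; have [l /andP[kl li]] := other k i.
apply: (homologous_trans (step _ _ _ _ _ x' jk ab)).
apply: (homologous_trans (step _ _ _ _ _ x' kl _)); first by rewrite eq_sym; exact: ab.
exact: step.
Qed.
End Connected.

(** * The relation without a finite presentation *)

Section AddDiff.
Variable d : nat.

(** Positions are natural numbers, so that one formula serves in all degrees; both are genuine when
    [a < m]. *)
Definition add_diff (U : FImodule d) m (j : 'I_d) (a : nat) : {additive U m -> U m.+1} :=
  fim_act U (add_point (j, inord a)) \- fim_act U (add_point (j, inord a.+1)).

Lemma add_diffE (U : FImodule d) m j a (x : U m) : add_diff U m j a x =
  fim_act U (add_point (j, inord a)) x - fim_act U (add_point (j, inord a.+1)) x.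
Proof. by []. Qed.

Lemma add_diffB (U : FImodule d) m j a (x y : U m) :
  add_diff U m j a (x - y) = add_diff U m j a x - add_diff U m j a y.
Proof. exact: raddfB. Qed.

Lemma add_diff_mor (U V : FImodule d) (f : FImor U V) m j a (x : U m) :
  f m.+1 (add_diff U m j a x) = add_diff V m j a (f m x).
Proof. by rewrite !add_diffE raddfB !fim_natural. Qed.

(** Since [b <= a], inserting [b] shifts the position [a] to [a.+1]. *)
Lemma add_point_commute_inord m (i j : 'I_d) (a b : nat) : i != j -> (b <= a <= m)%N ->
  fi_comp (@add_point d m.+1 (j, inord a.+1)) (@add_point d m (i, inord b)) =
  fi_comp (add_point (i, inord b)) (add_point (j, inord a)).
Proof.
move=> ij /andP[ba am]; apply: add_point_commute => //; apply: val_inj; rewrite /= /bump !inordK; lia.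
Qed.

(** The strict bounds on [a] make [swap] apply to all four terms of the product. *)
Lemma add_diff_commute (U : FImodule d) m (i j : 'I_d) (a b : nat) (x : U m) :
  i != j -> (b < a < m)%N ->
  add_diff U m.+1 j a.+1 (add_diff U m i b x) = add_diff U m.+1 i b (add_diff U m j a x).
Proof.
move=> ij /andP[ba am].
have swap a' b' : (b' <= a' <= m)%N ->
    fim_act U (add_point (j, inord a'.+1)) (fim_act U (add_point (i, inord b')) x) =
    fim_act U (add_point (i, inord b')) (fim_act U (add_point (j, inord a')) x).
  move=> h; have := @fim_actM d U _ _ _ (add_point (j, inord a'.+1)) (@add_point d m (i, inord b')) x.
  by rewrite (add_point_commute_inord ij h) => /= <-; rewrite fim_actM.
rewrite !add_diffE !(raddfB (fim_act U _)) !swap; try lia.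
by rewrite !opprB addrACA [RHS]addrACA [- _ - _]addrC.
Qed.
End AddDiff.

(** * Singular chains and cycles as modules *)

Section ChainModule.
Variables (R : realType) (d : nat).
Local Notation star := (star R d).

Section Degree.
Variable k : nat.

Definition conf_chain_act n m (u : FIhom d n m) :
  {additive chain R (conf n star) k -> chain R (conf m star) k} := chain_map R (fi_conf R u) k.

Lemma conf_chain_act1 n : conf_chain_act (fi_id d n) =1 id.
Proof.
apply: (free_ext_uniq (v := idfun)) => s; rewrite /conf_chain_act chain_mapE; congr fbasis.
by apply/continuousEP => x; exact: fi_conf_id.
Qed.

Lemma conf_chain_actM n m p (v : FIhom d m p) (u : FIhom d n m) :
  conf_chain_act (fi_comp v u) =1 conf_chain_act v \o conf_chain_act u.
Proof.
apply: (free_ext_uniq (u := conf_chain_act (fi_comp v u))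
  (v := conf_chain_act v \o conf_chain_act u)) => s.
rewrite -[RHS]/(conf_chain_act v (conf_chain_act u (fbasis s))) /conf_chain_act !chain_mapE.
by congr fbasis; apply/continuousEP => x; rewrite !ccompE fi_conf_comp.
Qed.

Definition conf_chain : FImodule d := FIModule conf_chain_act1 conf_chain_actM.

Definition conf_cycle_act n m (u : FIhom d n m) :
  {additive cycle R (conf n star) k -> cycle R (conf m star) k} := cycle_map R (fi_conf R u) k.

Lemma conf_cycle_act1 n : conf_cycle_act (fi_id d n) =1 id.
Proof. by move=> z; apply: val_inj; exact: conf_chain_act1. Qed.

Lemma conf_cycle_actM n m p (v : FIhom d m p) (u : FIhom d n m) :
  conf_cycle_act (fi_comp v u) =1 conf_cycle_act v \o conf_cycle_act u.
Proof. by move=> z; apply: val_inj; exact: conf_chain_actM. Qed.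

Definition conf_cycle : FImodule d := FIModule conf_cycle_act1 conf_cycle_actM.

Lemma cycle_inclusion_natural n m (u : FIhom d n m) (z : conf_cycle n) :
  (\val : cycle R (conf m star) k -> conf_chain m) (fim_act conf_cycle u z) =
  fim_act conf_chain u (\val z).
Proof. by []. Qed.

Definition cycle_inclusion : FImor conf_cycle conf_chain :=
  @FIMor _ conf_cycle conf_chain
    (fun n => (\val : cycle R (conf n star) k -> chain R (conf n star) k))
    cycle_inclusion_natural.

Lemma homology_class_natural n m (u : FIhom d n m) (z : conf_cycle n) :
  quo_pi (boundaries R (conf m star) k) (fim_act conf_cycle u z) =
  fim_act (conf_homology R d k) u (quo_pi (boundaries R (conf n star) k) z).
Proof. by rewrite [RHS]homology_mapE. Qed.

Definition homology_class : FImor conf_cycle (conf_homology R d k) :=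
  @FIMor _ conf_cycle (conf_homology R d k)
    (fun n => quo_pi (boundaries R (conf n star) k)) homology_class_natural.
End Degree.

Lemma conf_boundary_natural n m (u : FIhom d n m) (c : conf_chain 1 n) :
  boundary R (conf m star) 1 (fim_act (conf_chain 1) u c) =
  fim_act (conf_chain 0) u (boundary R (conf n star) 1 c).
Proof. exact: chain_map_boundary. Qed.

Definition conf_boundary : FImor (conf_chain 1) (conf_chain 0) :=
  @FIMor _ (conf_chain 1) (conf_chain 0) (fun n => boundary R (conf n star) 1)
    conf_boundary_natural.
End ChainModule.

Lemma sum_delta d (U : FImodule d) m (P : pred ('I_d * 'I_m.+1)) r (x : U m) : P r ->
  \sum_(q | P q) fim_act U (add_point q) (if q == r then x else 0) = fim_act U (add_point r) x.
Proof.
move=> Pr; rewrite (bigD1 r) //= eqxx big1 ?addr0 // => q /andP[_ /negPf ->].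
exact: raddf0.
Qed.

Section Augmentation.
Variable d : nat.

Definition augmentation n : {additive principal d.+1 0 n -> int} := free_ext (fun=> 1).

Lemma augmentation_basis n (h : FIhom d.+1 0 n) : augmentation n (fbasis h) = 1.
Proof. exact: free_extE. Qed.

Lemma augmentation_unmark n j (x : principal d.+1 1 n) : augmentation n (unmark n j x) = 0.
Proof.
move: x; apply: (free_ext_uniq (u := augmentation n \o unmark n j) (v := \0)) => h.
rewrite -[LHS]/(augmentation n (unmark n j (fbasis h))).
by rewrite unmark_basis raddfB !augmentation_basis subrr.
Qed.
End Augmentation.

Lemma sub_triangle (V : zmodType) (a b c : V) : a - b - (a - c) + (b - c) = 0.
Proof. by rewrite opprB [a - b + _]addrC !subrKA subrr. Qed.

(** * The Koszul relation between three cycles *)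

Section Obstruction.
Variable R : realType.
Local Notation star := (star R 3).
Local Notation C := (conf_chain R 3).
Local Notation D U j a := (add_diff U _ (@inord 2 j) a).

Lemma letter_inj i j : (i < 3)%N -> (j < 3)%N -> (@inord 2 i == @inord 2 j) = (i == j).
Proof. by move=> i3 j3; rewrite -(inj_eq (@ord_inj _)) !inordK. Qed.

Lemma connecting_chain n (s : conf n star) j a :
  exists e : C 1 n.+1, conf_boundary R 3 n.+1 e = D (C 0) j a (point_chain R s).
Proof.
have [e eE] := conf_connected (fi_conf R (@add_point 3 _ (inord j, inord a.+1)) s)
  (fi_conf R (@add_point 3 _ (inord j, inord a)) s).
exists e; rewrite add_diffE -[LHS]/(boundary R _ 1 e) eE.
by congr (_ - _); rewrite -chain_map_point.
Qed.

Section Relation.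
Variables (k : nat) (S : C 0 k) (e0 e1 e2 : C 1 k.+1).
Hypotheses (k3 : (2 < k)%N).
Hypotheses (e0E : conf_boundary R 3 k.+1 e0 = D (C 0) 0 0 S)
  (e1E : conf_boundary R 3 k.+1 e1 = D (C 0) 1 1 S)
  (e2E : conf_boundary R 3 k.+1 e2 = D (C 0) 2 2 S).

Let dd : forall (U : FImodule 3) m i j a b (x : U m), (i < j < 3)%N -> (b < a < m)%N ->
  D U j a.+1 (D U i b x) = D U i b (D U j a x).
Proof.
move=> U m i j a b x /andP[ij j3] h; apply: add_diff_commute => //.
by rewrite letter_inj // ?ltn_eqF // (ltn_trans ij j3).
Qed.

Lemma commutator_cycle (z : C 1 k.+2) : conf_boundary R 3 k.+2 z = 0 ->
  exists w : conf_cycle R 3 1 k.+2, cycle_inclusion R 3 1 k.+2 w = z.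
Proof.
move=> z0; have zP : z \in @is_cycle R (conf k.+2 star) 1 by apply/eqP.
by exists (Cycle zP).
Qed.

(** A difference in colour [j] starts at position [j] and moves up by one for each difference of
    smaller colour already applied. *)
Definition z01 := D (C 1) 1 2 e0 - D (C 1) 0 0 e1.
Definition z02 := D (C 1) 2 3 e0 - D (C 1) 0 0 e2.
Definition z12 := D (C 1) 2 3 e1 - D (C 1) 1 1 e2.

(** The boundaries vanish because differences of distinct colours commute. For the same reason the
    six terms of the relation cancel in pairs as chains, and cycles embed in chains. *)
Lemma commutator_relation :
  exists w01 w02 w12 : conf_cycle R 3 1 k.+2,
    cycle_inclusion R 3 1 k.+2 w01 = z01 /\
    D (conf_cycle R 3 1) 2 4 w01 - D (conf_cycle R 3 1) 1 2 w02 + D (conf_cycle R 3 1) 0 0 w12 = 0.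
Proof.
have [w01 w01E] : exists w, cycle_inclusion R 3 1 k.+2 w = z01.
  apply: commutator_cycle; rewrite raddfB !add_diff_mor e0E e1E dd ?subrr //; lia.
have [w02 w02E] : exists w, cycle_inclusion R 3 1 k.+2 w = z02.
  apply: commutator_cycle; rewrite raddfB !add_diff_mor e0E e2E dd ?subrr //; lia.
have [w12 w12E] : exists w, cycle_inclusion R 3 1 k.+2 w = z12.
  apply: commutator_cycle; rewrite raddfB !add_diff_mor e1E e2E dd ?subrr //; lia.
exists w01, w02, w12; split=> //; apply: val_inj.
rewrite -[LHS]/(cycle_inclusion R 3 1 k.+3 _) raddfD raddfB !add_diff_mor w01E w02E w12E.
have -> : D (C 1) 2 4 z01 = D (C 1) 2 4 (D (C 1) 1 2 e0) - D (C 1) 2 4 (D (C 1) 0 0 e1).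
  exact: add_diffB.
have -> : D (C 1) 1 2 z02 = D (C 1) 1 2 (D (C 1) 2 3 e0) - D (C 1) 1 2 (D (C 1) 0 0 e2).
  exact: add_diffB.
have -> : D (C 1) 0 0 z12 = D (C 1) 0 0 (D (C 1) 2 3 e1) - D (C 1) 0 0 (D (C 1) 1 1 e2).
  exact: add_diffB.
have -> : D (C 1) 2 4 (D (C 1) 1 2 e0) = D (C 1) 1 2 (D (C 1) 2 3 e0) by apply: dd; lia.
have -> : D (C 1) 2 4 (D (C 1) 0 0 e1) = D (C 1) 0 0 (D (C 1) 2 3 e1) by apply: dd; lia.
have -> : D (C 1) 1 2 (D (C 1) 0 0 e2) = D (C 1) 0 0 (D (C 1) 1 1 e2) by apply: dd; lia.
exact: sub_triangle.
Qed.
End Relation.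
End Obstruction.

(** * The first cycle is not in the span *)

Section Final.
Variable R : realType.
Local Notation star := (star R 3).
Local Notation C := (conf_chain R 3).
Local Notation D U j a := (add_diff U _ (@inord 2 j) a).
Local Notation P k := (principal 3 k).

Definition crossing_chain_mor j : FImor (C 1) (P 1) :=
  @FIMor _ (C 1) (P 1) (fun n => crossing_chain R n j)
    (fun n m u c => @crossing_chain_natural R 2 n m u j c).

Definition state_chain_mor : FImor (C 0) (P 0) :=
  @FIMor _ (C 0) (P 0) (fun n => state_chain R 2 n)
    (fun n m u c => @state_chain_natural R 2 n m u c).

Definition unmark_mor (j : 'I_3) : FImor (P 1) (P 0) :=
  @FIMor _ (P 1) (P 0) (fun n => @unmark 2 n j) (fun n m u c => @unmark_act 2 n m u j c).

Lemma crossing_mor_class j n (w : conf_cycle R 3 1 n) :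
  crossing_mor R (d := 2) j n (homology_class R 3 1 n w) =
  crossing_chain_mor j n (cycle_inclusion R 3 1 n w).
Proof. exact: crossing_homologyE. Qed.

Lemma pair_inord_neq m (i j a b : nat) : (i < 3)%N -> (j < 3)%N -> (a <= m)%N -> (b <= m)%N ->
  ((@inord 2 i, @inord m a) == (@inord 2 j, @inord m b)) = (i == j) && (a == b).
Proof. by move=> i3 j3 am bm; rewrite xpair_eqE letter_inj // -(inj_eq (@ord_inj _)) !inordK. Qed.

(** This brings a difference into the form of a sum over all operations, as required by
    [peelable_syzygy]. *)
Lemma sum_delta_diff (U : FImodule 3) m (Q : pred ('I_3 * 'I_m.+1)) (j a : nat) (x : U m) :
  (forall b, Q (inord j, b)) ->
  \sum_(q | Q q) fim_act U (add_point q) ((if q == (inord j, inord a) then x else 0) -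
    (if q == (inord j, inord a.+1) then x else 0)) = D U j a x.
Proof.
move=> Qj; rewrite add_diffE.
under eq_bigr => q _ do rewrite (raddfB (fim_act U (add_point q))).
by rewrite sumrB !sum_delta.
Qed.

(** Peeling at colour 1 in M(1) shows that the crossings of [e0] are those of a homology class up to
    terms of colour 0. The differential kills the crossings of the class, which leaves a relation of
    colour 0 alone in M(0); peeling again gives the contradiction on augmentations. *)
Lemma class_not_in_span k (s : conf k.+1 star) (e0 e1 : C 1 k.+2) (w : conf_cycle R 3 1 k.+3) :
  (1 < k)%N ->
  conf_boundary R 3 k.+2 e0 = D (C 0) 0 0 (point_chain R s) ->
  cycle_inclusion R 3 1 k.+3 w = D (C 1) 1 2 e0 - D (C 1) 0 0 e1 ->
  ~ in_span [pred q | q.1 != inord 2] (homology_class R 3 1 k.+3 w).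
Proof.
move=> k1 e0E wE [v vE].
have colors (j : 'I_3) : (j != inord 2) && (j != inord 1) = (j == inord 0).
  by case: j => [[|[|[|?]]] ?] //; rewrite -!(inj_eq (@ord_inj _)) /= !inordK.
have crossings j : in_span [pred q | q.1 == inord 0]
    (crossing_chain_mor j k.+2 e0 - crossing_mor R (d := 2) j k.+2 (v (inord 1, inord 2))).
  (* The coefficients of the crossings of [w] minus those of its supposed expression; at [(1, 2)]
     only the terms of [e0] and [v] remain. *)
  pose f q := ((if q == (inord 1, inord 2) then crossing_chain_mor j k.+2 e0 else 0) -
      (if q == (inord 1, inord 3) then crossing_chain_mor j k.+2 e0 else 0)) -
    ((if q == (inord 0, inord 0) then crossing_chain_mor j k.+2 e1 else 0) -
      (if q == (inord 0, inord 1) then crossing_chain_mor j k.+2 e1 else 0)) -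
    crossing_mor R (d := 2) j k.+2 (v q).
  have f0 : \sum_(q | predC1 (inord 2) q.1) fim_act (P 1) (@add_point 3 k.+2 q) (f q) = 0.
    under eq_bigr => q _ do rewrite !(raddfB (fim_act (P 1) (add_point q)) (_ - _)).
    rewrite !sumrB !sum_delta_diff; try by move=> b; rewrite /= letter_inj.
    rewrite -!add_diff_mor -raddfB -wE -crossing_mor_class vE raddf_sum.
    rewrite -sumrB big1 // => q _.
    by rewrite fim_natural subrr.
  have := peelable_syzygy (@principal_peelable 3 1) f0 (q := (inord 1, inord 2)).
  rewrite /f eqxx !pair_inord_neq //; try lia.
  rewrite /= !subr0 letter_inj // => /(_ isT)[t tE]; exists t; rewrite tE.
  by apply: eq_bigl => q /=; exact: colors.
have [t tE] := choice crossings.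
pose x := state_chain_mor k.+1 (point_chain R s).
pose f q := (if q == (inord 0, inord 0) then x else 0) -
  (if q == (inord 0, inord 1) then x else 0) - \sum_j unmark_mor j k.+1 (t j q).
have f0 : \sum_(q | pred1 (inord 0) q.1) fim_act (P 0) (@add_point 3 k.+1 q) (f q) = 0.
  under eq_bigr => q _ do rewrite (raddfB (fim_act (P 0) (add_point q)) (_ - _)).
  rewrite sumrB sum_delta_diff; last by move=> b; rewrite /= eqxx.
  rewrite -add_diff_mor -e0E.
  have -> : state_chain_mor k.+2 (conf_boundary R 3 k.+2 e0) =
      \sum_j \sum_(q | q.1 == inord 0)
        fim_act (P 0) (@add_point 3 k.+1 q) (unmark_mor j k.+1 (t j q)).
    have -> : state_chain_mor k.+2 (conf_boundary R 3 k.+2 e0) =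
      \sum_j unmark_mor j k.+2 (crossing_chain_mor j k.+2 e0) by exact: state_boundary.
    (* Crossings of a homology class are killed by the differential, so subtracting them does not
       change the type of the boundary of [e0]. *)
    have cycle0 : \sum_j unmark_mor j k.+2 (crossing_mor R (d := 2) j k.+2 (v (inord 1, inord 2))) = 0.
      exact: unmark_crossing_homology.
    transitivity (\sum_j unmark_mor j k.+2 (crossing_chain_mor j k.+2 e0) -
        \sum_j unmark_mor j k.+2 (crossing_mor R (d := 2) j k.+2 (v (inord 1, inord 2)))).
      by rewrite cycle0 subr0.
    rewrite -sumrB.
    apply: eq_bigr => j _.
    rewrite -[LHS]/(unmark_mor j k.+2 _ - unmark_mor j k.+2 _) -raddfB tE raddf_sum.
    by apply: eq_bigr => q _; rewrite fim_natural.
  rewrite exchange_big -sumrB big1 // => q _.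
  by rewrite raddf_sum subrr.
(* With only colour 0 present, the span of the other colours is zero. So the coefficient at [(0, 0)]
   vanishes, although its augmentation is that of [x], namely 1. *)
have [t' ] := peelable_syzygy (@principal_peelable 3 0) f0 (q := (inord 0, inord 0)) (eqxx _).
rewrite big_pred0 => [|q]; last by rewrite /= andbN.
move/(congr1 (augmentation 2 k.+1)); rewrite raddf0 /f eqxx pair_inord_neq //= subr0.
rewrite raddfB /= raddf_sum big1 ?subr0 => [|j _]; last exact: augmentation_unmark.
rewrite /x -[state_chain_mor _ _]/(state_chain R 2 k.+1 _) /point_chain state_chain_basis.
by rewrite augmentation_basis.
Qed.
End Final.

Theorem theorem1p3 (R : realType) :
  ~ finitely_presentable (conf_homology R 3 1).
Proof.
move=> /fp_syzygy[N NP].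
(* Three particles beyond [N] give the bound [2 < k] needed for the relation. *)
have [s _] := conf_inhabited R N.+3.
have [e0 e0E] := connecting_chain s 0 0.
have [e1 e1E] := connecting_chain s 1 1.
have [e2 e2E] := connecting_chain s 2 2.
have k3 : (2 < N.+3)%N by [].
have [w01 [w02 [w12 [w01E rel]]]] := commutator_relation k3 e0E e1E e2E.
apply: (class_not_in_span (isT : (1 < N.+2)%N) e0E w01E).
have NN : (N <= N.+4)%N by lia.
(* The relation expresses the operation [(2, 4)] on the class of [w01] through the other five
   operations occurring in it, all different from [(2, 4)]. *)
have := NP N.+4 NN (inord 2, inord 4) (homology_class R 3 1 N.+4.+1 w01); apply.
have := congr1 (homology_class R 3 1 N.+4.+2) rel.
rewrite raddf0 raddfD raddfB !add_diff_mor [add_diff _ _ _ 4 _]add_diffE.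
set u := fim_act _ (add_point (inord 2, inord 4)) _; move/eqP.
rewrite -!addrA addr_eq0; move/eqP->.
apply: in_spanN; apply: in_spanD.
  by apply: in_spanN; apply: in_span_act; rewrite /= pair_inord_neq //; lia.
by apply: in_spanD; [apply: in_spanN|]; rewrite add_diffE; apply: in_spanB; apply: in_span_act;
  rewrite /= pair_inord_neq //; lia.
Qed.
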